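(* Let $I\subset S$ be a Borel fixed ideal all of whose minimal monomial generators have degree at most $d$, and let $\Theta=\{x_{i,1}-x_{i,j}\mid 1\le i\le n,\ 2\le j\le d\}\subset\widetilde S$, so that $\widetilde S/(\Theta)\cong S$ via $x_{i,j}\mapsto x_i$. Then $\widetilde P_\bullet\otimes_{\widetilde S}\widetilde S/(\Theta)$ is a minimal $S$-free resolution of $S/I$.
   Context: Let $\Bbbk$ be a field and $S=\Bbbk[x_1,\dots,x_n]$. For a monomial ideal $J$, $G(J)$ denotes its set of minimal monomial generators. A monomial ideal $I\subset S$ is Borel fixed (strongly stable) if $m\in G(I)$, $x_i\mid m$ and $j<i$ imply $(x_j/x_i)\,m\in I$. Fix such an $I$ and an integer $d$ with $\deg m\le d$ for all $m\in G(I)$. Let $\widetilde S=\Bbbk[x_{i,j}\mid 1\le i\le n,\ 1\le j\le d]$. A monomial $m\in S$ of degree $e\le d$ is written uniquely as $m=\prod_{i=1}^e x_{\alpha_i}$ with $\alpha_1\le\cdots\le\alpha_e$; set $\widetilde m=\operatorname{b-pol}(m):=\prod_{i=1}^e x_{\alpha_i,i}\in\widetilde S$, and $\widetilde I=\operatorname{b-pol}(I):=(\widetilde m\mid m\in G(I))\subset \widetilde S$. For a monomial $m$ let $\mu(m)=\min\{i: x_i\mid m\}$ and $\nu(m)=\max\{i: x_i\mid m\}$ (with $\mu(1)=\infty$). Every monomial $m\in I$ has a unique expression $m=m_1m_2$ with $\nu(m_1)\le\mu(m_2)$ and $m_1\in G(I)$; put $g(m):=m_1$. For a monomial $m=\prod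 x_l^{a_l}$ and $i<\nu(m)$ put $\mathfrak b_i(m):=(x_i/x_k)\,m$ with $k=\min\{j>i: a_j>0\}$. For $m\in G(I)$ put $m_{\langle i\rangle}:=g(\mathfrak b_i(m))$ if $1\le i<\nu(m)$, $m_{\langle i\rangle}:=m$ if $i\ge\nu(m)$, and $\widetilde m_{\langle i\rangle}:=\operatorname{b-pol}(m_{\langle i\rangle})$. For a finite set $\widetilde F=\{(i_1,j_1),\dots,(i_q,j_q)\}\subset\mathbb N\times\mathbb N$ and $m=\prod x_l^{a_l}\in G(I)$, the pair $(\widetilde F,\widetilde m)$ is admissible if (a) $1\le i_1<\cdots<i_q<\nu(m)$ and (b) $j_r=1+\sum_{l=1}^{i_r}a_l$ for all $r$; the pair $(\emptyset,\widetilde m)$ is also admissible. Put $\widetilde F_r:=\widetilde F\setminus\{(i_r,j_r)\}$, and for $(\widetilde F,\widetilde m)$ admissible put $B(\widetilde F,\widetilde m):=\{r\mid 1\le r\le q,\ (\widetilde F_r,\widetilde m_{\langle i_r\rangle})\text{ is admissible}\}$. The complex $\widetilde P_\bullet$ of free $\widetilde S$-modules: $\widetilde P_0=\widetilde S$, and for $q\ge1$, $\widetilde P_q=\bigoplus \widetilde S\,e(\widetilde F,\widetilde m)$, the sum over admissible pairs with $\#\widetilde F=q-1$. The differential $\partial:\widetilde P_{q+1}\to\widetilde P_q$ ($q\ge1$) sends $e(\widetilde F,\widetilde m)$ with $\widetilde F=\{(i_1,j_1),\dots,(i_q,j_q)\}$, $i_1<\dots<i_q$, to $$\sum_{1\le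 r\le q}(-1)^r x_{i_r,j_r}\,e(\widetilde F_r,\widetilde m)-\sum_{r\in B(\widetilde F,\widetilde m)}(-1)^r\frac{x_{i_r,j_r}\,\widetilde m}{\widetilde m_{\langle i_r\rangle}}\,e(\widetilde F_r,\widetilde m_{\langle i_r\rangle}),$$ and $\partial:\widetilde P_1\to\widetilde P_0$ sends $e(\emptyset,\widetilde m)$ to $\widetilde m$. *)

(* Defs.v *)
From HB Require Import structures.
From mathcomp Require Import all_boot all_order all_algebra.
From mathcomp Require Import generic_quotient ring_quotient.
From mathcomp Require Export mpoly.

Set Implicit Arguments.
Unset Strict Implicit.
Unset Printing Implicit Defensive.

Import GRing.Theory.
Local Open Scope ring_scope.
Local Open Scope quotient_scope.

(* The submodule (A)M of M, where (A) is the ideal generated by A;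
   for M = R^o this is the ideal (A) itself. *)
Definition ideal_mul (R : comNzRingType) (A : R -> Prop) (M : lmodType R)
    (v : M) : Prop :=
  exists (r : nat) (a : 'I_r -> R) (w : 'I_r -> M),
    (forall i, A (a i)) /\ v = \sum_(i < r) a i *: w i.

Definition gen_ideal (R : comNzRingType) (A : R -> Prop) (f : R) : Prop :=
  ideal_mul A (f : R^o).

(* f identifies the quotient ring R/(A) with R'. *)
Definition quotient_map (R R' : comNzRingType) (A : R -> Prop)
    (f : {rmorphism R -> R'}) : Prop :=
  (forall y, exists x, f x = y) /\ (forall x, f x = 0 <-> gen_ideal A x).

Definition free_mod (R : comNzRingType) (B : finType) := {ffun B -> R^o}.

(* A sequence ... -> P_1 -> P_0 of free modules with chosen finite bases,
   given by the images of the basis elements. That consecutive maps compose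
   to zero is not built in; it is part of being a resolution. *)
Record free_seq (R : comNzRingType) := FreeSeq {
  basis : nat -> finType;
  dbasis : forall q, basis q.+1 -> free_mod R (basis q)
}.

Definition term (R : comNzRingType) (P : free_seq R) (q : nat) : lmodType R :=
  free_mod R (basis P q).

Definition diff (R : comNzRingType) (P : free_seq R) (q : nat)
    (v : free_mod R (basis P q.+1)) : free_mod R (basis P q) :=
  \sum_b v b *: dbasis b.
Arguments diff {R} P q v.

Definition map_free (R R' : comNzRingType) (f : {rmorphism R -> R'})
    (B : finType) (v : free_mod R B) : free_mod R' B := [ffun b => f (v b)].

(* P (x)_R R', where R' is an R-algebra through f; see base_change_univ and
   base_change_diff below. *)
Definition base_change (R R' : comNzRingType) (f : {rmorphism R -> R'})
    (P : free_seq R) : free_seq R' :=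
  FreeSeq (fun q (b : basis P q.+1) => map_free f (dbasis b)).

(* P is a free resolution of the R-module R/I; the augmentation is R-linear,
   R acting on R/I through the projection. *)
Definition resolves_quotient (R : comNzRingType) (P : free_seq R)
    (I : idealr R) : Prop :=
  (exists aug : {linear term P 0 -> {ideal_quot I} | \pi_{ideal_quot I} \; *%R},
     (forall y, exists v, aug v = y) /\
     (forall v, aug v = 0 <-> exists w, diff P 0 w = v)) /\
  (forall q v, diff P q v = 0 <-> exists w, diff P q.+1 w = v).

(* Minimality over a polynomial ring: the image of each differential lies in
   (x_1, ..., x_n) P. *)
Definition minimal (k : fieldType) (n : nat) (P : free_seq {mpoly k[n]}) :
    Prop :=
  forall q v, ideal_mul (fun f : {mpoly k[n]} => exists i : 'I_n, f = 'X_i)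
                (diff P q v : term P q).

(* Variables are indexed from 0: the usual x_1, ..., x_n are 'X_0, ...,
   'X_(n-1).  The library type idealr consists of proper ideals; I = S must be
   excluded, since 0 -> S -> S -> 0 is not a minimal resolution of S/S. *)

Section Borel.
Variables (k : fieldType) (n : nat).
Implicit Types (I : idealr {mpoly k[n]}) (m : 'X_{1..n}) (i j : 'I_n).

Definition monomial_ideal I : Prop :=
  exists M : 'X_{1..n} -> Prop, forall f,
    f \in I <-> gen_ideal (fun g => exists2 m, M m & g = 'X_[m]) f.

(* m \in G(I); a divisor of m has degree at most mdeg m. *)
Definition mingen I m : bool :=
  ('X_[m] \in I) &&
  [forall m' : 'X_{1..n < (mdeg m).+1},
     ((m' <= m)%MM && ('X_[m'] \in I)) ==> (m' == m :> 'X_{1..n})].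

Definition borel_fixed I : Prop :=
  monomial_ideal I /\
  forall m i j, mingen I m -> (0 < m i)%N -> (j < i)%N ->
    'X_[m - U_(i) + U_(j)] \in I.

(* nu and mu are 1-based; nu 1 = 0, and n.+1 plays the role of mu(1) = oo. *)
Definition nu m : nat := \max_(i < n | (0 < m i)%N) i.+1.
Definition mu m : nat := \big[minn/n.+1]_(i < n | (0 < m i)%N) i.+1.

(* g(m) for a monomial m of I (m itself when there is no m_1). *)
Definition gpart I m : 'X_{1..n} :=
  if [pick m1 : 'X_{1..n < (mdeg m).+1} |
        [&& (m1 <= m)%MM, mingen I m1 & (nu m1 <= mu (m - m1)%MM)%N]]
    is Some m1 then (m1 : 'X_{1..n}) else m.

(* b_i(m), for i < nu(m). *)
Definition bmove i m : 'X_{1..n} :=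
  if [pick l : 'I_n | [&& (i < l)%N, (0 < m l)%N &
        [forall j : 'I_n, (i < j < l)%N ==> (m j == 0%N)]]]
    is Some l then (m - U_(l) + U_(i))%MM else m.

(* m_<i> *)
Definition mbra I m i : 'X_{1..n} :=
  if (i.+1 < nu m)%N then gpart I (bmove i m) else m.

End Borel.

(* The variables of S~ = k[x_{i,j}] are numbered by the enumeration of
   'I_n * 'I_d. *)

Notation nvar n d := (#|{: 'I_n * 'I_d}|).

Section Polarization.
Variables (k : fieldType) (n d : nat).

Definition xvar (i : 'I_n) (j : 'I_d) : {mpoly k[nvar n d]} :=
  'X_(enum_rank (i, j)).

(* alpha_1 <= ... <= alpha_e *)
Definition word (m : 'X_{1..n}) : seq 'I_n :=
  flatten [seq nseq (m i) i | i <- enum 'I_n].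

(* Exponent of b-pol(m), for m of degree at most d. *)
Definition bpol (m : 'X_{1..n}) : 'X_{1..nvar n d} :=
  (\sum_(j < d)
     if onth (word m) j is Some i then U_(enum_rank (i, j)) else 0)%MM.

Definition Theta (f : {mpoly k[nvar n d]}) : Prop :=
  exists (i : 'I_n) (j1 j : 'I_d),
    [/\ j1 = 0%N :> nat, (0 < j)%N & f = xvar i j1 - xvar i j].

Definition depol : {mpoly k[nvar n d]} -> {mpoly k[n]} :=
  comp_mpoly [tuple 'X_(enum_val v).1 | v < nvar n d].

HB.instance Definition _ := GRing.RMorphism.on depol.

Variable I : idealr {mpoly k[n]}.
Implicit Types (F : {set 'I_n * 'I_d}) (m : 'X_{1..n}) (p : 'I_n * 'I_d).

(* The condition on j_r reads j_r = 1 + sum_(l <= i_r) a_l with 1-based j_r;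
   as i_r < nu(m), it forces j_r <= deg m <= d, so that sets of pairs in
   'I_n * 'I_d suffice. *)
Definition admissible F m : bool :=
  [&& mingen I m,
      [forall p in F, forall p' in F, (p.1 == p'.1) ==> (p == p')],
      [forall p in F, (p.1.+1 < nu m)%N] &
      [forall p in F, p.2 == (\sum_(l < n | (l <= p.1)%N) m l)%N :> nat]].

(* The position r of p = (i_r, j_r) in F, from 1 to q. *)
Definition pos F p : nat := #|[set p' in F | (p'.1 <= p.1)%N]|.

Definition Pbasis (q : nat) : finType :=
  if q is q'.+1 then
    {x : {set 'I_n * 'I_d} * 'X_{1..n < d.+1}
       | admissible x.1 x.2 && (#|x.1| == q')} : finType
  else unit.

(* The basis element e(F, m~) of P~_q, q >= 1 (zero if the pair is not
   admissible). *)
Definition Pe (q : nat) F m : free_mod {mpoly k[nvar n d]} (Pbasis q.+1) :=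
  [ffun x : Pbasis q.+1 =>
     (((val x).1 == F) && ((val x).2 == m :> 'X_{1..n}))%:R].

(* The monomial quotient in the second sum is exact for p in B(F, m~),
   hence the truncated subtraction of exponents. *)
Definition Pdiff (q : nat) :
    Pbasis q.+1 -> free_mod {mpoly k[nvar n d]} (Pbasis q) :=
  match q return Pbasis q.+1 -> free_mod {mpoly k[nvar n d]} (Pbasis q) with
  | 0 => fun x => [ffun _ => 'X_[bpol (val x).2]]
  | q'.+1 => fun x =>
      let F := (val x).1 in
      let m : 'X_{1..n} := (val x).2 in
      \sum_(p in F) ((-1) ^+ pos F p * xvar p.1 p.2) *: Pe q' (F :\ p) m
      - \sum_(p in F | admissible (F :\ p) (mbra I m p.1))
          ((-1) ^+ pos F p
           * 'X_[U_(enum_rank p) + bpol m - bpol (mbra I m p.1)])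
          *: Pe q' (F :\ p) (mbra I m p.1)
  end.

Definition Pcomplex : free_seq {mpoly k[nvar n d]} := FreeSeq Pdiff.

End Polarization.

Arguments xvar {k n d} i j.
Arguments depol {k n d} _.

Definition delta (R : comNzRingType) (B : finType) (b : B) : free_mod R B :=
  [ffun c => (c == b)%:R].
Arguments delta {R B} b.

Lemma free_mod_sum (R : comNzRingType) (B : finType) (v : free_mod R B) :
  v = \sum_b v b *: delta b.
Proof.
apply/ffunP=> c; rewrite sum_ffunE (bigD1 c) //= !ffunE eqxx.
rewrite big1 ?addr0 => [|b nbc]; first by rewrite /GRing.scale /= mulr1.
by rewrite !ffunE eq_sym (negPf nbc) /GRing.scale /= mulr0.
Qed.

Lemma map_free_delta (R R' : comNzRingType) (f : {rmorphism R -> R'})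
    (B : finType) (b : B) : map_free f (delta b) = delta b.
Proof. by apply/ffunP=> c; rewrite !ffunE rmorph_nat. Qed.

Lemma base_change_univ (R R' : comNzRingType) (f : {rmorphism R -> R'})
    (B : finType) (L : lmodType R')
    (h : {linear free_mod R B -> L | f \; *:%R}) :
  exists2 h' : {linear free_mod R' B -> L},
    forall v, h' (map_free f v) = h v &
    forall h'' : {linear free_mod R' B -> L},
      (forall v, h'' (map_free f v) = h v) -> h'' =1 h'.
Proof.
pose g (v : free_mod R' B) : L := \sum_b v b *: h (delta b).
have lin_g : linear g.
  move=> a u v; rewrite /g scaler_sumr -big_split; apply: eq_bigr => b _ /=.
  by rewrite !ffunE scalerDl scalerA.
pose h' : {linear free_mod R' B -> L} :=
  HB.pack g (GRing.isLinear.Build _ _ _ _ g lin_g).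
exists h' => [v|h'' h''E v].
  rewrite [in RHS](free_mod_sum v) linear_sum; apply: eq_bigr => b _.
  by rewrite linearZ /= ffunE.
rewrite [in LHS](free_mod_sum v) linear_sum; apply: eq_bigr => b _.
by rewrite linearZ /= -h''E map_free_delta.
Qed.

Lemma base_change_diff (R R' : comNzRingType) (f : {rmorphism R -> R'})
    (P : free_seq R) (q : nat) (v : free_mod R (basis P q.+1)) :
  diff (base_change f P) q (map_free f v) = map_free f (diff P q v).
Proof.
apply/ffunP=> c; rewrite !ffunE !sum_ffunE rmorph_sum; apply: eq_bigr => b _.
by rewrite !ffunE /GRing.scale /= rmorphM.
Qed.

(* Main.v *)
(* Polarization indices disappear after setting x_(i,j) = x_i, so the complex is
   studied directly over S. In terms of the cumulative degrees
   s_m(l) = sum_(i <= l) m_i, a pair (i, j) may occur in F for m exactly when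
   j = s_m(i) < deg m, the move b_i adds 1 to s_m where l >= i and
   s_m(l) = s_m(i), and taking a prefix of the sorted word truncates s_m; this
   turns d o d = 0 into arithmetic on minima. For exactness, m_<i> is
   lexicographically larger than m, so on lexicographically smallest terms the
   differential is the Koszul differential on the variables x_i with
   i < nu(m). A cycle is therefore pushed to larger and larger terms by adding
   boundaries coming from the standard Koszul homotopy, which divides by the
   smallest available variable. *)
From HB Require Import structures.
Require Import Defs.
From mathcomp Require Import all_boot all_order all_algebra.
From mathcomp Require Import generic_quotient ring_quotient.
From mathcomp Require Import zify.

Set Implicit Arguments.
Unset Strict Implicit.
Unset Printing Implicit Defensive.

Import GRing.Theory.
Local Open Scope ring_scope.

(* zify chokes on hypotheses about ideals and polynomials. *)
Ltac nlia :=
  repeat match goal with H : ?P |- _ =>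
    lazymatch P with
    | is_true (leq _ _) => fail
    | @eq nat _ _ => fail
    | is_true (~~ leq _ _) => fail
    | is_true (_ && _) => fail
    | _ = true => fail
    | _ = false => fail
    | _ => clear H
    end end; lia.

(** Two points are delicate. In d o d = 0 the terms cannot be matched formally: when p is removed
    and m is replaced by m_<p>, the pair may fail to be admissible and become so again once a second
    element p' is removed. The cure is a comparison of the two orders of removal: either the moves
    at p and p' commute, or the one of larger index is absorbed by the other ([mbra_exchange]). In
    exactness the obstacle is the end of the Koszul complex: its homology there consists of the
    polynomials free of the variables x_i with i < nu(m). So a relation between generators must be
    shown to have no such part in its lexicographically smallest coefficient. The reason is the
    linear quotient property of Borel ideals: no monomial free of those variables carries m into the
    ideal of the other generators of at least its rank ([colon_lex]). *)

Section Cumulative.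
Variable n : nat.
Implicit Types (m u v : 'X_{1..n}) (i j l : 'I_n).

(** * Cumulative degrees and prefixes of sorted words *)

Definition cumul m l : nat := (\sum_(i < n | (i <= l)%N) m i)%N.

Lemma cumul_mdeg m l : (cumul m l <= mdeg m)%N.
Proof. by rewrite mdegE [X in (_ <= X)%N](bigID (fun i : 'I_n => (i <= l)%N))
  leq_addr. Qed.

Lemma cumul_leq m i l : (i <= l)%N -> (m i <= cumul m l)%N.
Proof. by move=> il; rewrite /cumul (bigD1 i) //= leq_addr. Qed.

Lemma cumul_mono m i l : (i <= l)%N -> (cumul m i <= cumul m l)%N.
Proof.
move=> il; rewrite /cumul [X in (_ <= X)%N](bigID (fun j : 'I_n => (j <= i)%N))
  /=.
rewrite [X in (_ <= X + _)%N](eq_bigl (fun j : 'I_n => (j <= i)%N)) ?leq_addr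
  //.
by move=> j /=; case: (leqP j i) => ji; rewrite ?andbF // (leq_trans ji il).
Qed.

Lemma cumul_step m i l : (i < l)%N -> (cumul m i + m l <= cumul m l)%N.
Proof.
move=> il; rewrite /cumul [X in (_ <= X)%N](bigD1 l) //= addnC leq_add2l.
rewrite [X in (_ <= X)%N](bigID (fun j : 'I_n => (j <= i)%N)) /=.
rewrite [X in (_ <= X + _)%N](eq_bigl (fun j : 'I_n => (j <= i)%N)) ?leq_addr
  //.
move=> j /=; case: (leqP j i) => ji; rewrite ?andbF ?andbT //.
by rewrite (leq_trans ji (ltnW il)) /=; apply/eqP=> jl; move: ji;
  rewrite jl leqNgt il.
Qed.

Lemma cumulS m i l : l = i.+1 :> nat -> cumul m l = (cumul m i + m l)%N.
Proof.
move=> li; rewrite /cumul (bigD1 l) //= addnC; congr addn;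
  apply: eq_bigl => j /=.
by rewrite -val_eqE /=; nlia.
Qed.

Lemma cumul_first m i : i = 0%N :> nat -> cumul m i = m i.
Proof.
move=> i0; rewrite /cumul (big_pred1 i) // => j /=.
by rewrite -val_eqE /=; nlia.
Qed.

Lemma cumul_inj_on m u i :
  (forall l, (l <= i)%N -> cumul m l = cumul u l) -> m i = u i.
Proof.
move=> h; case i0: (i : nat) => [|k]; first by rewrite -!cumul_first // h.
have kn : (k < n)%N by have := ltn_ord i; nlia.
have := h i (leqnn _).
rewrite (@cumulS m (Ordinal kn) i) // (@cumulS u (Ordinal kn) i) //.
by rewrite (h (Ordinal kn)) /=; nlia.
Qed.

Lemma cumulD m u l : cumul (m + u)%MM l = (cumul m l + cumul u l)%N.
Proof. by rewrite /cumul -big_split; apply: eq_bigr => i _; rewrite mnmDE. Qed.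

Lemma cumulU i l : cumul U_(i)%MM l = (i <= l)%N.
Proof.
rewrite /cumul; case: leqP => il.
  rewrite (bigD1 i) //= mnm1E eqxx big1 // => j /andP[_ ji].
  by rewrite mnm1E eq_sym (negPf ji).
rewrite big1 // => j jl; rewrite mnm1E; case: eqP => // e.
by move: jl; rewrite -e leqNgt il.
Qed.

Lemma cumul_lepm m u l : (m <= u)%MM -> (cumul m l <= cumul u l)%N.
Proof. by move/mnm_lepP=> h; apply: leq_sum. Qed.

Lemma mdeg_lepm m u : (m <= u)%MM -> (mdeg m <= mdeg u)%N.
Proof. by move/mnm_lepP=> h; rewrite !mdegE; apply: leq_sum. Qed.

Lemma lepm_mdeg_eq m u : (m <= u)%MM -> (mdeg u <= mdeg m)%N -> m = u.
Proof.
move=> mu; have := submK mu => e; rewrite -{1}e mdegD.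
rewrite -[X in (_ <= X)%N -> _]add0n leq_add2r leqn0 mdeg_eq0 => /eqP e0.
by rewrite -e e0 add0m.
Qed.

(* In terms of the sorted word of a monomial, m is a prefix of u. *)
Definition prefix_of m (f : 'I_n -> nat) : Prop :=
  forall l, cumul m l = minn (f l) (mdeg m).

Lemma prefix_lepm m u : prefix_of m (cumul u) -> (m <= u)%MM.
Proof.
move=> h; apply/mnm_lepP=> i; case i0: (i : nat) => [|k].
  by rewrite -!cumul_first // h geq_minl.
have kn : (k < n)%N by have := ltn_ord i; nlia.
have mE := @cumulS m (Ordinal kn) i i0.
have uE := @cumulS u (Ordinal kn) i i0.
rewrite !h in mE; nlia.
Qed.

(** Two truncations of the same word are nested. The function f is arbitrary, so that the word of
    b_i(m) can be given by its values without naming a monomial. *)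
Lemma prefix_comparable m u (f : 'I_n -> nat) :
  prefix_of m f -> prefix_of u f -> (mdeg m <= mdeg u)%N ->
  prefix_of m (cumul u).
Proof. by move=> mf uf mu l; rewrite mf uf; nlia. Qed.

Lemma mnm_maxvar m : m != 0%MM ->
  exists i, (0 < m i)%N /\ forall j, (i < j)%N -> m j = 0%N.
Proof.
move=> m0; have [i0 mi0] : exists i, (0 < m i)%N.
  apply/existsP; apply: contra_neqT m0; rewrite negb_exists => /forallP h.
  by apply/mnmP=> i; rewrite mnm0E; have := h i; nlia.
case: (@arg_maxnP _ i0 (fun i => 0 < m i)%N (fun i : 'I_n => i : nat) mi0) => i
  mi h.
exists i; split=> // j ij; apply/eqP; rewrite -leqn0 leqNgt; apply/negP=> /h /=.
by nlia.
Qed.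

Lemma mnm_neq_lt m u : (m <= u)%MM -> m != u -> exists i, (m i < u i)%N.
Proof.
move=> /mnm_lepP mu ne; apply/existsP; apply: contra_neqT ne.
rewrite negb_exists => /forallP h; apply/mnmP=> i.
by have := h i; have := mu i; nlia.
Qed.


Lemma nu_ltE m i : (i.+1 < nu m)%N = [exists l : 'I_n, (i < l)%N && (0 < m
  l)%N].
Proof.
rewrite /nu; apply/idP/existsP=> [h|[l /andP[il ml]]]; last first.
  by apply: (@leq_trans l.+1) => //;
    apply: (@leq_bigmax_cond _ _ (fun i : 'I_n => i.+1) l).
have [l ml|h0] := pickP (fun l : 'I_n => (i < l)%N && (0 < m l)%N);
  first by exists l.
suff : (\max_(i0 < n | (0 < m i0)%N) i0.+1 <= i.+1)%N by rewrite leqNgt h.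
by apply/bigmax_leqP=> l ml; have := h0 l; rewrite ml andbT; nlia.
Qed.

Lemma nu_cs m i : (i.+1 < nu m)%N = (cumul m i < mdeg m)%N.
Proof.
rewrite nu_ltE mdegE (bigID (fun l : 'I_n => (l <= i)%N)) /= -/(cumul m i).
rewrite -[X in _ = (X < _)%N]addn0 ltn_add2l.
apply/existsP/idP => [[l /andP[il ml]]|].
  by rewrite (bigD1 l) -?ltnNge //= ltn_addr.
rewrite lt0n; case: (pickP (fun l : 'I_n => (i < l)%N && (0 < m l)%N)) =>
  [l|h0].
  by exists l.
rewrite big1 // => l il; have := h0 l; rewrite ltnNge il /=; nlia.
Qed.

(** The bound on k is the value of the empty minimum, so the equivalence also covers m = 1. *)
Lemma mu_geP m k : (k <= n.+1)%N ->
  (k <= mu m)%N <-> (forall i, (0 < m i)%N -> (k <= i.+1)%N).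
Proof.
move=> kn; rewrite /mu; split=> [h i mi|h].
  apply: leq_trans h _; have := mem_index_enum i.
  elim: (index_enum _) => //= j r IH; rewrite inE big_cons => /predU1P[<-|/IH].
    by rewrite mi geq_minl.
  by case: ifP => // _; apply: leq_trans; apply: geq_minr.
elim/big_ind: _ => // x y; rewrite leq_min => -> -> //.
Qed.

Lemma nu_leP m k : (nu m <= k)%N <-> (forall i, (0 < m i)%N -> (i < k)%N).
Proof. by split=> [/bigmax_leqP h i /h|h]; last apply/bigmax_leqP. Qed.

Lemma nu_le_mu m u : (nu m <= mu u)%N <->
  (forall i j, (0 < m i)%N -> (0 < u j)%N -> (i <= j)%N).
Proof.
have mun : (nu m <= n.+1)%N by apply/nu_leP => i _; have := ltn_ord i; nlia.
rewrite mu_geP //; split=> [h i j mi uj|h j uj].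
  by have /nu_leP/(_ i mi) := h j uj.
by apply/nu_leP => i mi; apply: h.
Qed.

(** If a variable of index at most l is left over in u - m, then all of m lies at indices at most l
    and the truncation is reached; otherwise m and u agree up to l. Conversely, a leftover x_j makes
    the count of m at j smaller than that of u, hence already full, so m has no letter after x_j. *)
Lemma gsplit_prefix m u : (m <= u)%MM ->
  (nu m <= mu (u - m)%MM)%N <-> prefix_of m (cumul u).
Proof.
move=> mu; have /mnm_lepP le := mu; rewrite nu_le_mu; split=> [h l|h i j mi].
  have [j /andP[jl mj]|h0] := pickP (fun j => (j <= l)%N && (m j < u j)%N).
    have mE : cumul m l = mdeg m.
      rewrite mdegE (bigID (fun i : 'I_n => (i <= l)%N)) /= -/(cumul m l) big1
        ?addn0 //.
      move=> i; rewrite -ltnNge => li; apply/eqP; rewrite -leqn0 leqNgt.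
      apply/negP=> mi; have := h i j mi; rewrite mnmBE; nlia.
    by have := cumul_lepm l mu; rewrite mE; nlia.
  suff e : cumul m l = cumul u l by have := cumul_mdeg m l; rewrite e; nlia.
  by apply: eq_bigr => i il; have := h0 i; rewrite il /=; have := le i; nlia.
rewrite mnmBE => uj; rewrite leqNgt; apply/negP=> ji.
have lt : (cumul m j < cumul u j)%N.
  rewrite /cumul [X in (X < _)%N](bigD1 j) //= [X in (_ < X)%N](bigD1 j) //=
    -addSn.
  by apply: leq_add; [nlia|apply: leq_sum].
have := h j; have := cumul_step m ji; have := cumul_mdeg m i; nlia.
Qed.

End Cumulative.

(** * Generators as prefixes, and the moves m_<i>, in a Borel ideal *)

Section BorelCombinatorics.
Variables (k : fieldType) (n : nat) (I : idealr {mpoly k[n]}).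
Hypothesis borelI : borel_fixed I.
Implicit Types (m u v : 'X_{1..n}) (i j l : 'I_n).

Lemma mnm_ideal_up m u : (m <= u)%MM -> 'X_[m] \in I -> 'X_[u] \in I.
Proof. by move=> mu; rewrite -(submK mu) mpolyXD; apply: idealMr. Qed.

Lemma mingen_ideal m : mingen I m -> 'X_[m] \in I.
Proof. by case/andP. Qed.

Lemma mingen_min m u : mingen I m -> (u <= m)%MM -> 'X_[u] \in I -> u = m.
Proof.
case/andP=> _ /forallP h um uI.
have ub : (mdeg u < (mdeg m).+1)%N by rewrite ltnS mdeg_lepm.
by have := h (BMultinom ub); rewrite /= um uI => /eqP.
Qed.

Lemma mingen_neq0 m : mingen I m -> m != 0%MM.
Proof.
by move=> /mingen_ideal mI; apply/eqP=> m0; move: mI;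
  rewrite m0 mpolyX0 idealr1.
Qed.

Lemma mingen_prefix u : 'X_[u] \in I ->
  exists m, mingen I m /\ prefix_of m (cumul u).
Proof.
elim/ltn_ind: {u}(mdeg u) {-2}u (erefl (mdeg u)) => e IH u ue uI.
have [ug|] := boolP (mingen I u).
  by exists u; split=> // l; have := cumul_mdeg u l; nlia.
rewrite /mingen uI /= negb_forall => /existsP[w].
rewrite negb_imply => /andP[/andP[wu wI] wNu].
have wlt : (mdeg w < e)%N.
  rewrite -ue ltn_neqAle mdeg_lepm // andbT; apply: contra_neqN wNu => ewu.
  by apply: (lepm_mdeg_eq wu); rewrite (eqP ewu).
have [v [vg /prefix_lepm vw]] := IH _ wlt _ erefl wI.
have vu := lepm_trans vw wu.
have vltu : (mdeg v < mdeg u)%N by have := mdeg_lepm vw; nlia.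
have u0 : u != 0%MM by apply/eqP=> u0; move: vltu; rewrite u0 mdeg0.
have [x [ux xmax]] := mnm_maxvar u0.
have xu : (U_(x) <= u)%MM by rewrite lep1mP; nlia.
have u'I : 'X_[u - U_(x)] \in I.
  have [vx|vx] := ltnP (v x) (u x).
    apply: (mnm_ideal_up _ (mingen_ideal vg)); apply/mnm_lepP=> j.
    rewrite mnmBE mnm1E; have /mnm_lepP/(_ j) := vu.
    by case: (x =P j) => [<-|_]; nlia.
  (* Now v contains every copy of x that u has, so it lacks some x_j with j < x. Trading one x of v
     for x_j gives a divisor of u / x. *)
  have vNu : v != u by apply/eqP=> e'; move: vltu; rewrite e' ltnn.
  have [j vj] := mnm_neq_lt vu vNu.
  have jx : (j < x)%N.
    rewrite ltn_neqAle leqNgt; apply/andP; split; last first.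
      by apply/negP=> /xmax; nlia.
    by apply/eqP=> /val_inj jx; move: vj; rewrite jx; nlia.
  have hv := borelI.2 v x j vg (leq_trans ux vx) jx.
  apply: (mnm_ideal_up _ hv); apply/mnm_lepP=> l.
  rewrite mnmDE !mnmBE !mnm1E; have /mnm_lepP/(_ l) := vu.
  have [xl|xl] := eqVneq x l; last by rewrite subn0; case: (j =P l) => [<-|_];
    nlia.
  by rewrite -xl -val_eqE (ltn_eqF jx) => ?; nlia.
have u'lt : (mdeg (u - U_(x)) < e)%N.
  by have := submK xu => /(congr1 (@mdeg n)); rewrite mdegD mdeg1; nlia.
have [m [mg mp]] := IH _ u'lt _ erefl u'I.
exists m; split=> // l; rewrite mp.
have := submK xu => /(congr1 (fun w => (cumul w l, mdeg w))).
rewrite cumulD cumulU mdegD mdeg1 => -[<- _].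
case: leqP => xl; last by rewrite addn0.
(* From x on, u / x already counts its full degree, so the extra letter of u is cut off by the
   truncation at [mdeg m]. *)
have := mdeg_lepm (prefix_lepm mp).
suff -> : cumul (u - U_(x))%MM l = mdeg (u - U_(x))%MM by nlia.
rewrite mdegE (bigID (fun i : 'I_n => (i <= l)%N)) /= -/(cumul _ l) big1 ?addn0
  //.
by move=> i il; rewrite mnmBE xmax //; nlia.
Qed.

Lemma mingen_prefix_uniq m u (f : 'I_n -> nat) :
  mingen I m -> mingen I u -> prefix_of m f -> prefix_of u f -> m = u.
Proof.
move=> mg ug mf uf; case/orP: (leq_total (mdeg m) (mdeg u)) => h.
  apply: (mingen_min ug _ (mingen_ideal mg)).
  exact: prefix_lepm (prefix_comparable mf uf h).
apply/esym/(mingen_min mg _ (mingen_ideal ug)).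
exact: prefix_lepm (prefix_comparable uf mf h).
Qed.

Lemma gpartP u : 'X_[u] \in I ->
  mingen I (gpart I u) /\ prefix_of (gpart I u) (cumul u).
Proof.
move=> uI; rewrite /gpart;
  case: pickP => [m /and3P[mu mg /(gsplit_prefix mu)] //|h].
have [m [mg mp]] := mingen_prefix uI; have mu := prefix_lepm mp.
have mb : (mdeg m < (mdeg u).+1)%N by rewrite ltnS mdeg_lepm.
have := h (BMultinom mb); rewrite /= mu mg /=.
by have /(gsplit_prefix mu) -> := mp.
Qed.

(** The letter that is changed is the first one after the block of x_i, so the cumulative degree is
    constant from i up to just before its variable, and it rises by one exactly on that stretch. *)
Lemma bmoveP m i : mingen I m -> (cumul m i < mdeg m)%N ->
  [/\ 'X_[bmove i m] \in I, mdeg (bmove i m) = mdeg m &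
      forall l, cumul (bmove i m) l
                = (cumul m l + ((i <= l)%N && (cumul m l == cumul m i)))%N].
Proof.
move=> mg; rewrite -nu_cs nu_ltE => /existsP[l0 l0P].
rewrite /bmove; case: pickP => [x /and3P[ix mx /forallP h]|h]; last first.
  case: (@arg_minnP _ l0 (fun l => (i < l) && (0 < m l))%N (fun l : 'I_n => l :
    nat) l0P) => l /andP[il ml] lmin.
  have := h l; rewrite il ml /=; move/negP; case; apply/forallP=> j.
  apply/implyP=> /andP[ij jl]; rewrite -leqn0 leqNgt; apply/negP=> mj.
  by have := lmin j; rewrite ij mj /=; nlia.
have xm : (U_(x) <= m)%MM by rewrite lep1mP; nlia.
split=> [||l].
- exact: borelI.2.
- have := submK xm => /(congr1 (@mdeg n)); rewrite !mdegD !mdeg1; nlia.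
have := submK xm => /(congr1 (fun w => cumul w l));
  rewrite !cumulD !cumulU => e.
have [xl|lx] := leqP x l.
  have := cumul_step m ix; have := cumul_mono m xl.
  move: e; rewrite xl => e; nlia.
rewrite leqNgt lx /= addn0 in e.
have [il|il] /= := leqP i l; last by nlia.
suff : cumul m l = cumul m i by nlia.
rewrite /cumul (bigID (fun j : 'I_n => (j <= i)%N)) /= [X in (_ + X)%N]big1
  ?addn0.
  by apply: eq_bigl => j; nlia.
move=> j /andP[jl ij]; apply/eqP; have := h j; rewrite -ltnNge in ij.
by rewrite ij (leq_ltn_trans jl lx).
Qed.

(** For the lower bound on the degree: a prefix of length at most [cumul m i] is not touched by the
    move, so it would be a prefix of m lying in I, hence m itself, which is longer. *)
Lemma mbraP m i : mingen I m -> (cumul m i < mdeg m)%N ->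
  [/\ mingen I (mbra I m i), (cumul m i < mdeg (mbra I m i) <= mdeg m)%N &
      prefix_of (mbra I m i)
        (fun l => (cumul m l + ((i <= l)%N && (cumul m l == cumul m i)))%N)].
Proof.
move=> mg im; have [bI bdeg bcs] := bmoveP mg im.
rewrite /mbra nu_cs im; have [gg gp] := gpartP bI.
have glt := mdeg_lepm (prefix_lepm gp); rewrite bdeg in glt.
split=> //; last by move=> l; rewrite gp bcs.
rewrite glt andbT ltnNge; apply/negP=> le.
have gm : gpart I (bmove i m) = m.
  apply: (mingen_min mg _ (mingen_ideal gg)); apply: prefix_lepm => l.
  by rewrite gp bcs; case: eqP; nlia.
by move: le; rewrite gm leqNgt im.
Qed.

End BorelCombinatorics.

(** * Closure properties of (A)M *)

Section IdealMul.
Variables (R : comNzRingType) (A : R -> Prop).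

Lemma ideal_mul0 (M : lmodType R) : ideal_mul A (0 : M).
Proof. by exists 0%N, (fun=> 0), (fun=> 0); rewrite big_ord0;
  split=> // -[]. Qed.

Lemma ideal_mulD (M : lmodType R) (u v : M) :
  ideal_mul A u -> ideal_mul A v -> ideal_mul A (u + v).
Proof.
move=> [r [a [w [Aa ->]]]] [s [b [z [Ab ->]]]].
exists (r + s)%N, (fun i => match split i with inl x => a x | inr y => b y end),
  (fun i => match split i with inl x => w x | inr y => z y end).
split=> [i|]; first by case: (split i).
rewrite big_split_ord; congr (_ + _); apply: eq_bigr => i _.
  by rewrite (unsplitK (inl i)).
by rewrite (unsplitK (inr i)).
Qed.

Lemma ideal_mulZ (M : lmodType R) c (v : M) :
  ideal_mul A v -> ideal_mul A (c *: v).
Proof.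
move=> [r [a [w [Aa ->]]]]; exists r, a, (fun i => c *: w i); split=> //.
by rewrite scaler_sumr; apply: eq_bigr => i _; rewrite !scalerA mulrC.
Qed.

Lemma ideal_mul_gen (M : lmodType R) a (v : M) : A a -> ideal_mul A (a *: v).
Proof. by exists 1%N, (fun=> a), (fun=> v); rewrite big_ord1. Qed.

Lemma ideal_mul_sum (M : lmodType R) (J : Type) (r : seq J) (P : pred J)
    (F : J -> M) :
  (forall j, P j -> ideal_mul A (F j)) -> ideal_mul A (\sum_(j <- r | P j) F j).
Proof.
by move=> h; elim/big_ind: _ => //; [exact: ideal_mul0 | exact: ideal_mulD].
Qed.

Lemma gen_ideal0 : gen_ideal A 0.
Proof. exact: (@ideal_mul0 R^o). Qed.

Lemma gen_idealD x y : gen_ideal A x -> gen_ideal A y -> gen_ideal A (x + y).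
Proof. exact: (@ideal_mulD R^o). Qed.

Lemma gen_idealM x y : gen_ideal A y -> gen_ideal A (x * y).
Proof. exact: (@ideal_mulZ R^o). Qed.

Lemma gen_ideal_gen x y : A x -> gen_ideal A (x * y).
Proof. exact: (@ideal_mul_gen R^o). Qed.

End IdealMul.

Lemma mpoly_ring_ind (R : comNzRingType) (n : nat) (P : {mpoly R[n]} -> Prop) :
  (forall c, P c%:MP) -> (forall i, P 'X_i) ->
  (forall x y, P x -> P y -> P (x + y)) ->
  (forall x y, P x -> P y -> P (x * y)) -> forall x, P x.
Proof.
move=> hC hX hD hM; elim/mpolyind => [|c u p _ _ IH].
  by rewrite -(mpolyC0 n R); apply: (hC).
apply: (hD) IH; rewrite -mul_mpolyC; apply: (hM) (hC c) _.
rewrite mpolyXE_id; elim/big_ind: _ => [|x y|i _].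
- by rewrite -(mpolyC1 n R); apply: (hC).
- exact: hM.
elim: (u i) => [|e IHe]; first by rewrite expr0 -(mpolyC1 n R); apply: (hC).
by rewrite exprS; apply: (hM).
Qed.

(** * The map x_(i,j) -> x_i, its kernel, and its effect on b-pol *)

Section Depolarization.
Variables (k : fieldType) (n d : nat).
Implicit Types (m : 'X_{1..n}) (u v : 'X_{1..nvar n d}) (i : 'I_n) (j : 'I_d).

Definition mnm_depol u : 'X_{1..n} := (\sum_v U_((enum_val v).1) *+ u v)%MM.

Lemma depolX u : depol ('X_[u] : {mpoly k[nvar n d]}) = 'X_[mnm_depol u].
Proof.
rewrite /depol comp_mpolyX /mnm_depol -mprodXE.
by apply: eq_bigr => v _; rewrite tnth_mktuple mpolyXn.
Qed.

Lemma depol_xvar i j : depol (xvar i j : {mpoly k[nvar n d]}) = 'X_i.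
Proof.
rewrite /depol /xvar comp_mpolyXU -tnth_nth tnth_mktuple.
by rewrite enum_rankK.
Qed.

Lemma mnm_depolE u i : mnm_depol u i = (\sum_(j < d) u (enum_rank (i, j)))%N.
Proof.
rewrite /mnm_depol mnm_sumE (reindex (@enum_rank ('I_n * 'I_d)%type)) /=;
  last first.
  by exists enum_val => ? _; rewrite ?enum_rankK ?enum_valK.
under eq_bigr do rewrite mulmnE mnm1E enum_rankK.
transitivity (\sum_a \sum_(b < d) (a == i) * u (enum_rank (a, b)))%N.
  by rewrite pair_bigA; apply: eq_bigr => -[].
rewrite (bigD1 i) //= [X in (_ + X)%N]big1 ?addn0.
  by apply: eq_bigr => j _; rewrite eqxx mul1n.
by move=> a /negPf ai; rewrite big1 // => j _; rewrite ai.
Qed.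

Lemma mnm_depolD u v : mnm_depol (u + v)%MM = (mnm_depol u + mnm_depol v)%MM.
Proof.
apply/mnmP=> i; rewrite mnmDE !mnm_depolE -big_split.
by apply: eq_bigr => j _; rewrite mnmDE.
Qed.

Lemma mnm_depolU (p : 'I_n * 'I_d) : mnm_depol U_(enum_rank p)%MM = U_(p.1)%MM.
Proof.
apply/mnmP=> i; rewrite mnm_depolE mnm1E.
rewrite (bigD1 p.2) //= big1 => [|j jp]; rewrite mnm1E (inj_eq enum_rank_inj).
  by rewrite addn0 -pair_eqE /= eqxx andbT.
by rewrite -pair_eqE /= [_ == j]eq_sym (negPf jp) andbF.
Qed.

(** The block of x_i starts after all smaller variables, at position [cumul m i - m i]; the
    subtraction stands for the cumulative degree at i - 1 and also makes sense for i = 0. *)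
Lemma onth_word m i (j : nat) :
  (onth (word m) j == Some i) = (cumul m i - m i <= j < cumul m i)%N.
Proof.
have sE : enum 'I_n = take i (enum 'I_n) ++ i :: drop i.+1 (enum 'I_n).
  have iN : (i < size (enum 'I_n))%N by rewrite size_enum_ord.
  by rewrite -{1}(cat_take_drop i (enum 'I_n)) (drop_nth i iN) nth_ord_enum.
have := enum_uniq 'I_n;
  rewrite {1}sE cat_uniq /= negb_or => /and3P[_ /andP[iT _] /andP[iD _]].
have iF (s : seq 'I_n) : i \notin s -> i \notin flatten [seq nseq (m x) x | x
  <- s].
  apply: contra => /flatten_mapP[x xs]; rewrite mem_nseq => /andP[_ /eqP ->] //.
have szT : size (flatten [seq nseq (m x) x | x <- take i (enum 'I_n)])
           = (cumul m i - m i)%N.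
  rewrite size_flatten /shape -map_comp (eq_map (g := m)); last first.
    by move=> x /=; rewrite size_nseq.
  rewrite sumnE big_map big_uniq ?take_uniq ?enum_uniq //=.
  rewrite /cumul [in RHS](bigD1 i) //= addnC addnK; apply: eq_bigl => x.
  by rewrite in_take ?mem_enum // index_enum_ord -val_eqE /=; lia.
rewrite /word sE map_cat flatten_cat /= onth_cat szT.
have mle : (m i <= cumul m i)%N by apply: cumul_leq.
case: ltnP => jT.
  rewrite (introF eqP) => [|e]; first by lia.
  by have /onthPn/(_ j) := iF _ iT; rewrite e eqxx.
rewrite onth_cat size_nseq onth_nseq; case: ltnP => jm.
  by rewrite eqxx; lia.
rewrite (introF eqP) => [|e]; first by lia.
have /onthPn/(_ (j - (cumul m i - m i) - m i)%N) := iF _ iD.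
by rewrite e eqxx.
Qed.

Lemma bpolE m i j :
  bpol d m (enum_rank (i, j)) = (cumul m i - m i <= j < cumul m i)%N.
Proof.
rewrite /bpol mnm_sumE (bigD1 j) //= big1 ?addn0 => [|j' jj'].
  rewrite -onth_word; case: (onth _ _) => [x|]; last by rewrite mnm0E.
  by rewrite mnm1E (inj_eq enum_rank_inj) xpair_eqE eqxx andbT.
case: (onth _ _) => [x|]; last by rewrite mnm0E.
by rewrite mnm1E (inj_eq enum_rank_inj) xpair_eqE (negPf jj') andbF.
Qed.

(** [bpol] keeps the first d letters of the word; the degree bound says that these are all of
    them. *)
Lemma mnm_depol_bpol m : (mdeg m <= d)%N -> mnm_depol (bpol d m) = m.
Proof.
move=> md; apply/mnmP=> i; rewrite mnm_depolE.
under eq_bigr do rewrite bpolE.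
have cd : (cumul m i <= d)%N by rewrite (leq_trans (cumul_mdeg m i)).
have mle : (m i <= cumul m i)%N by apply: cumul_leq.
rewrite -(big_mkord xpredT (fun j : nat => nat_of_bool (cumul m i - m i <= j <
  cumul m i)%N)).
rewrite (@big_cat_nat _ _ _ (cumul m i - m i)) //=; last by lia.
rewrite (@big_cat_nat _ _ _ (cumul m i) (cumul m i - m i)) //=; last by lia.
rewrite big_nat big1 ?add0n; last by move=> j; lia.
rewrite [X in (_ + X)%N]big_nat [X in (_ + X)%N]big1 ?addn0; last by move=> j;
  lia.
rewrite big_nat (eq_bigr (fun=> 1%N)); last by move=> j; lia.
by rewrite -big_nat sum_nat_const_nat muln1; lia.
Qed.

Hypothesis d_gt0 : (0 < d)%N.

Let pol0 : {mpoly k[n]} -> {mpoly k[nvar n d]} :=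
  comp_mpoly [tuple xvar i (Ordinal d_gt0) | i < n].

Let pol0K y : depol (pol0 y) = y.
Proof.
elim/mpolyind: y => [|c m p _ _ IH]; first by rewrite /pol0 !raddf0.
rewrite /pol0 comp_mpolyD raddfD /= -/(pol0 p) IH; congr (_ + _).
rewrite -mul_mpolyC !rmorphM /= comp_mpolyC /depol comp_mpolyC; congr (_ * _).
rewrite comp_mpolyX rmorph_prod mpolyXE_id; apply: eq_bigr => i _.
by rewrite rmorphXn /= tnth_mktuple -/(depol _) depol_xvar.
Qed.

(** This bounds the kernel of [depol]. The polynomials with this property contain the constants, are
    closed under sums and products, and contain the variables, for which the difference is zero or
    minus an element of Theta. *)
Let pol0_depol x : gen_ideal (@Theta k n d) (x - pol0 (depol x)).
Proof.
elim/mpoly_ring_ind: x => [c|v|x y hx hy|x y hx hy].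
- by rewrite /pol0 /depol !comp_mpolyC subrr; apply: gen_ideal0.
- rewrite -[v]enum_valK; case: (enum_val v) => i j.
  rewrite -/(xvar i j) depol_xvar /pol0 comp_mpolyXU -tnth_nth tnth_mktuple.
  have [->|j0] := eqVneq j (Ordinal d_gt0).
    by rewrite subrr; apply: gen_ideal0.
  have -> : xvar i j - xvar i (Ordinal d_gt0)
     = (xvar i (Ordinal d_gt0) - xvar i j) * (-1) :> {mpoly k[nvar n d]}.
    by rewrite mulrN1 opprB.
  apply: gen_ideal_gen; exists i, (Ordinal d_gt0), j; split=> //.
  by rewrite lt0n; apply: contra j0 => /eqP j00; apply/eqP/val_inj.
- rewrite raddfD /= /pol0 raddfD /= -/pol0 opprD addrACA.
  by move: hx hy; move: (pol0 _) (pol0 _) => ? ?; apply: gen_idealD.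
rewrite rmorphM /= /pol0 rmorphM /= -/pol0.
move: hx hy; move: (pol0 (depol x)) (pol0 (depol y)) => x' y' hx hy.
have -> : x * y - x' * y' = y * (x - x') + x' * (y - y').
  by rewrite !mulrBr [y * x]mulrC [y * x']mulrC addrA subrK.
by apply: gen_idealD; apply: gen_idealM.
Qed.

Lemma depol_quotient_map : quotient_map (@Theta k n d) depol.
Proof.
split=> [y|x]; first by exists (pol0 y); apply: pol0K.
split=> [x0|[r [a [w [Aa ->]]]]].
  by have := pol0_depol x; rewrite x0 /pol0 raddf0 subr0.
rewrite rmorph_sum big1 // => i _; rewrite rmorphM.
have [i' [j1 [j [_ _ ->]]]] := Aa i.
by rewrite rmorphB /= !depol_xvar subrr mul0r.
Qed.

End Depolarization.

(** * Admissible pairs and their behaviour under moves *)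

Section Admissible.
Variables (k : fieldType) (n d : nat) (I : idealr {mpoly k[n]}).
Hypothesis borelI : borel_fixed I.
Implicit Types (m u v w : 'X_{1..n}) (F : {set 'I_n * 'I_d}) (p : 'I_n * 'I_d).

Definition node m p : bool := (p.2 == cumul m p.1 :> nat) && (cumul m p.1 <
  mdeg m)%N.

(** As the second coordinate of an element is determined by the first, admissibility becomes a
    condition on single elements and so passes to subsets. *)
Lemma admissibleE F m :
  admissible I F m = mingen I m && [forall p in F, node m p].
Proof.
rewrite /admissible; congr (_ && _);
  apply/and3P/forall_inP => [[_ /forall_inP hn /forall_inP hc] p pF|h].
  by rewrite /node (hc p pF) -nu_cs hn.
split; apply/forall_inP=> p pF; have /andP[pc plt] := h p pF => //.
  apply/forall_inP => p' p'F; have /andP[p'c _] := h p' p'F.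
  apply/implyP=> /eqP e; apply/eqP; move: pc p'c;
    rewrite -e => /eqP pc /eqP p'c.
  case: p p' e pc p'c {pF p'F plt} => [a b] [a' b'] /= -> eb eb'.
  by congr pair; apply: val_inj; rewrite /= eb eb'.
by rewrite nu_cs.
Qed.

Lemma admissibleP F m :
  reflect (mingen I m /\ forall p, p \in F -> node m p) (admissible I F m).
Proof. by rewrite admissibleE; apply: (iffP andP) => -[? /forall_inP]. Qed.

Lemma node_inj m p p' : node m p -> node m p' -> p.1 = p'.1 -> p = p'.
Proof.
case: p p' => [a b] [a' b'] /andP[/eqP /= eb _] /andP[/eqP /= eb' _] e.
by move: eb'; rewrite -e -eb => /val_inj ->.
Qed.

(** The word of b_i(m) differs from that of m in one letter, which becomes x_i, at the 0-based
    position [cumul m i]. In the polarization this new letter is the variable of p; all others come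
    from b-pol(m), and m_<i> is a prefix. *)
Lemma bpol_mbra_le m p : mingen I m -> node m p ->
  (bpol d (mbra I m p.1) <= U_(enum_rank p) + bpol d m)%MM.
Proof.
move=> mg /andP[/eqP p2 plt]; have [_ /andP[pL Lm] mp] := mbraP borelI mg plt.
apply/mnm_lepP=> x; rewrite -[x]enum_valK; case: (enum_val x) => l j.
rewrite mnmDE !bpolE mnm1E (inj_eq enum_rank_inj) [p]surjective_pairing
  xpair_eqE /=.
(* The cumulative degree just before l; passing from l to l - 1 turns [p.1 <= l] into [p.1 < l]. *)
have he' : (cumul (mbra I m p.1) l - mbra I m p.1 l = minn (cumul m l - m l
    + ((p.1 < l) && (cumul m l - m l == cumul m p.1))) (mdeg (mbra I m p.1)))%N.
  case l0: (l : nat) => [|l']; first by rewrite !(cumul_first _ l0); nlia.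
  have l'n : (l' < n)%N by have := ltn_ord l; nlia.
  rewrite (@cumulS _ m (Ordinal l'n)) // (@cumulS _ (mbra I m p.1) (Ordinal
    l'n)) //.
  by rewrite !addnK mp.
have hi : (p.1 < l)%N -> (cumul m p.1 <= cumul m l - m l)%N by move/(cumul_step
  m); lia.
have hl : (l <= p.1)%N -> (cumul m l <= cumul m p.1)%N by move/(cumul_mono m).
rewrite he' mp -val_eqE -[p.2 == j]val_eqE /= p2.
move: pL hi hl (cumul_leq m (leqnn l)).
move: (mdeg _) (cumul m p.1) (cumul m l) (m l) (val p.1) (val l) (val j).
clear=> L a c b i y z; case: (ltngtP i y) => ? /=; lia.
Qed.

(** The node p survives when neither the move changes the value that is its second coordinate nor
    the truncation reaches it. *)
Lemma node_mbra m i p : mingen I m -> (cumul m i < mdeg m)%N -> node m p ->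
  node (mbra I m i) p = ~~ ((i <= p.1)%N && (cumul m p.1 == cumul m i))
                        && (cumul m p.1 < mdeg (mbra I m i))%N.
Proof.
move=> mg im /andP[/eqP p2 _]; have [_ /andP[iL _] mp] := mbraP borelI mg im.
by rewrite /node p2 mp; nlia.
Qed.

(** The move at p' acts behind position [p.2], so p stays a node of m_<p'>. If the cumulative
    degrees at p and p' coincide, both moves rewrite the same letter: the one at p destroys the node
    p' and overrides an earlier move at p'. The same outcome holds if m_<p> ends before the letter
    rewritten at p'. Otherwise the moves rewrite different letters and commute. *)
Lemma mbra_exchange F m p p' (F2 := F :\ p :\ p') (mp := mbra I m p.1)
    (mp' := mbra I m p'.1) :
    admissible I F m -> p \in F -> p' \in F -> (p.1 < p'.1)%N ->
  (admissible I F2 mp' -> admissible I (F :\ p') mp') /\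
  ([/\ ~~ admissible I (F :\ p) mp, mbra I mp' p.1 = mp &
       admissible I F2 mp -> admissible I (F :\ p') mp'] \/
   [/\ mbra I mp p'.1 = mbra I mp' p.1,
       admissible I F2 (mbra I mp' p.1) ->
         admissible I (F :\ p) mp /\ admissible I (F :\ p') mp' &
       admissible I F2 mp -> admissible I (F :\ p) mp]).
Proof.
move=> /admissibleP[mg hF] pF p'F lt.
have /andP[_ im] := hF p pF; have /andP[_ jm] := hF p' p'F.
have [ig /andP[iL iD] ip] := mbraP borelI mg im.
have [jg /andP[jL jD] jp] := mbraP borelI mg jm.
rewrite -/mp in ig iL iD ip; rewrite -/mp' in jg jL jD jp.
have ab : (cumul m p.1 <= cumul m p'.1)%N by apply/cumul_mono/ltnW.
have nodeE s : s \in F -> node mp s = ~~ ((p.1 <= s.1)%N && (cumul m s.1 ==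
  cumul m p.1))
                        && (cumul m s.1 < mdeg mp)%N.
  by move=> sF; apply: node_mbra => //; apply: hF.
have node'E s : s \in F -> node mp' s = ~~ ((p'.1 <= s.1)%N && (cumul m s.1 ==
  cumul m p'.1))
                        && (cumul m s.1 < mdeg mp')%N.
  by move=> sF; apply: node_mbra => //; apply: hF.
have pNp' : p != p' by apply: contraTneq lt => ->; rewrite ltnn.
have adm_p' : (forall s, s \in F2 -> node mp' s) -> admissible I (F :\ p') mp'.
  move=> h; apply/admissibleP; split=> // s; rewrite !inE => /andP[sp' sF].
  have [->|sp] := eqVneq s p; last by apply: h; rewrite !inE sp sp'.
  by rewrite node'E // leqNgt lt /=; nlia.
have ci : cumul mp' p.1 = cumul m p.1 by rewrite jp leqNgt lt /=; nlia.
have im' : (cumul mp' p.1 < mdeg mp')%N by rewrite ci; nlia.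
have [g2 /andP[L2 D2] p2] := mbraP borelI jg im'.
have mono (l : 'I_n) : (p.1 <= l)%N -> (cumul m p.1 <= cumul m l)%N by
  move/(cumul_mono m).
have mono' (l : 'I_n) : (p'.1 <= l)%N -> (cumul m p'.1 <= cumul m l)%N by
  move/(cumul_mono m).
have mono'' (l : 'I_n) : (l <= p'.1)%N -> (cumul m l <= cumul m p'.1)%N by
  move/(cumul_mono m).
split; first by case/admissibleP=> _ /adm_p'.
have [eab|nab] := eqVneq (cumul m p.1) (cumul m p'.1).
  left; have e : mbra I mp' p.1 = mp.
    apply: (mingen_prefix_uniq g2 ig _ ip) => l; rewrite p2 ci jp.
    move: D2 jL (mono l) (mono' l) (mono'' l); rewrite eab; clear -lt.
    move: (mdeg _) (mdeg _) (cumul m l) (cumul m p'.1) => *.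
    lia.
  split=> //.
    apply/negP=> /admissibleP[_ /(_ p')];
      rewrite !inE eq_sym pNp' p'F => /(_ isT).
    by rewrite nodeE // ltnW // eab eqxx.
  case/admissibleP=> _ h; apply: adm_p' => s sF2; have := h s sF2.
  have sF : s \in F by move: sF2; rewrite !inE => /and3P[].
  rewrite nodeE // node'E // -eab; rewrite e in D2.
  clear -lt D2; nlia.
have ltab : (cumul m p.1 < cumul m p'.1)%N by rewrite ltn_neqAle nab.
(* Does m_<p> still contain the letter that the move at p' rewrites? *)
have [Lb|bL] := leqP (mdeg mp) (cumul m p'.1).
  left; split.
  - apply/negP=> /admissibleP[_ /(_ p')];
    rewrite !inE eq_sym pNp' p'F => /(_ isT).
    by rewrite nodeE // [(_ < mdeg mp)%N]ltnNge Lb andbF.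
  - apply: (mingen_prefix_uniq g2 ig p2) => l; rewrite ip ci jp.
    nlia.
  case/admissibleP=> _ h; apply: adm_p' => s sF2; have := h s sF2.
  have sF : s \in F by move: sF2; rewrite !inE => /and3P[].
  rewrite nodeE // node'E //; nlia.
right; have cj : cumul mp p'.1 = cumul m p'.1 by rewrite ip; nlia.
have jm' : (cumul mp p'.1 < mdeg mp)%N by rewrite cj.
have [g1 /andP[L1 D1] p1] := mbraP borelI ig jm'.
have p2' : prefix_of (mbra I mp' p.1) (fun l => (cumul m l
    + ((p.1 <= l) && (cumul m l == cumul m p.1))
    + ((p'.1 <= l) && (cumul m l == cumul m p'.1)))%N).
  move=> l; rewrite p2 ci jp; move: (mono' l); nlia.
have e : mbra I mp p'.1 = mbra I mp' p.1.
  apply: (mingen_prefix_uniq g1 g2 _ p2') => l.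
  rewrite p1 cj ip; move: (mono l) (mono' l); nlia.
have adm_p : (forall s, s \in F2 -> node mp s) -> admissible I (F :\ p) mp.
  move=> h; apply/admissibleP; split=> // s; rewrite !inE => /andP[sp sF].
  have [->|sp'] := eqVneq s p'; last by apply: h; rewrite !inE sp sp'.
  by rewrite nodeE // [_ == cumul m p.1]eq_sym (negPf nab) andbF.
split=> //; last by case/admissibleP=> _ /adm_p.
rewrite e in D1; case/admissibleP=> _ h; split;
  [apply: adm_p|apply: adm_p'] => s sF2;
  have := h s sF2; have sF : s \in F by [move: sF2; rewrite !inE => /and3P[]];
  have /andP[/eqP s2 _] := hF s sF; rewrite ?nodeE ?node'E // /node s2 p2';
  move: D1 D2; move: (mdeg _) (mdeg _) (mdeg _) (cumul m s.1) (cumul m p.1);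
  by move: (cumul m p'.1) (val p.1) (val p'.1) (val s.1); clear; lia.
Qed.

End Admissible.

(** * Linearity of differentials and base change *)

Section FreeSeq.
Variables (R : comNzRingType) (P : free_seq R).

Lemma diff_is_linear q : linear (@diff R P q).
Proof.
move=> c u v; rewrite /diff scaler_sumr -big_split; apply: eq_bigr => b _ /=.
by rewrite !ffunE scalerDl scalerA.
Qed.

Lemma diff0 q : diff P q 0 = 0.
Proof. by apply: big1 => b _; rewrite ffunE scale0r. Qed.

Lemma diffZ q c v : diff P q (c *: v) = c *: diff P q v.
Proof. by rewrite -[c *: v]addr0 diff_is_linear diff0 addr0. Qed.

Lemma diffD q u v : diff P q (u + v) = diff P q u + diff P q v.
Proof. by rewrite -[u]scale1r diff_is_linear !scale1r. Qed.

Lemma diffB q u v : diff P q (u - v) = diff P q u - diff P q v.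
Proof. by rewrite -scaleN1r diffD diffZ scaleN1r. Qed.

Lemma diff_comb q a b u v :
  diff P q (a *: u - b *: v) = a *: diff P q u - b *: diff P q v.
Proof. by rewrite diffB !diffZ. Qed.

Lemma diff_sum q (J : Type) (r : seq J) (Q : pred J) F :
  diff P q (\sum_(j <- r | Q j) F j) = \sum_(j <- r | Q j) diff P q (F j).
Proof. by apply: big_morph; [apply: diffD|apply: diff0]. Qed.

Lemma diff_delta q b : diff P q (delta b) = dbasis b.
Proof.
rewrite /diff (bigD1 b) //= ffunE eqxx scale1r big1 ?addr0 // => c /negPf cb.
by rewrite ffunE cb scale0r.
Qed.

End FreeSeq.

Section MapFree.
Variables (R R' : comNzRingType) (f : {rmorphism R -> R'}) (B : finType).
Implicit Types u v : free_mod R B.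

Lemma map_free_comb (J : finType) (Q Q' : pred J) (a a' : J -> R)
    (v v' : J -> free_mod R B) :
  map_free f (\sum_(j | Q j) a j *: v j - \sum_(j | Q' j) a' j *: v' j) =
  \sum_(j | Q j) f (a j) *: map_free f (v j)
  - \sum_(j | Q' j) f (a' j) *: map_free f (v' j).
Proof.
apply/ffunP=> b; rewrite !ffunE !sum_ffunE rmorphB !rmorph_sum.
by congr (_ - _); apply: eq_bigr => j _; rewrite !ffunE /GRing.scale /= rmorphM.
Qed.

End MapFree.

(** * The complex over S, and d o d = 0 *)

Section Depolarized.
Variables (k : fieldType) (n d : nat) (I : idealr {mpoly k[n]}).
Hypothesis borelI : borel_fixed I.
Hypothesis degI : forall m : 'X_{1..n}, mingen I m -> (mdeg m <= d)%N.
Implicit Types (m u v w : 'X_{1..n}) (F : {set 'I_n * 'I_d}) (p : 'I_n * 'I_d).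

Definition depolP := base_change depol (Pcomplex d I).

(* Locked, as unification would otherwise unfold it at great cost. *)
Definition depolPe q F m : free_mod {mpoly k[n]} (Pbasis d I q.+1) :=
  locked [ffun x : Pbasis d I q.+1 =>
            (((val x).1 == F) && ((val x).2 == m :> 'X_{1..n}))%:R].

Lemma depolPeE q F m x : depolPe q F m x
  = (((val x).1 == F) && ((val x).2 == m :> 'X_{1..n}))%:R.
Proof. by rewrite /depolPe -lock ffunE. Qed.

Lemma map_free_Pe q F m : map_free depol (Pe I q F m) = depolPe q F m.
Proof. by apply/ffunP=> x; rewrite depolPeE !ffunE rmorph_nat. Qed.

Lemma depolPe_eq0 q F m : ~~ admissible I F m -> depolPe q F m = 0.
Proof.
move=> h; apply/ffunP=> x; rewrite depolPeE !ffunE;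
  case: andP => // -[/eqP e1 /eqP e2].
by have /andP[] := valP x; rewrite e1 e2 (negPf h).
Qed.

Definition mquot m p : 'X_{1..n} := (U_(p.1) + m - mbra I m p.1)%MM.

Lemma mbra_le m p : mingen I m -> node m p ->
  (mbra I m p.1 <= U_(p.1) + m)%MM.
Proof.
move=> mg pm; have := bpol_mbra_le borelI mg pm => /submK e.
have [ig _ _] := mbraP borelI mg (andP pm).2.
have := congr1 (@mnm_depol n d) e; rewrite !mnm_depolD mnm_depolU.
by rewrite !mnm_depol_bpol ?degI // => <-; apply: lem_addl.
Qed.

Lemma mquotK m p : mingen I m -> node m p ->
  (mquot m p + mbra I m p.1)%MM = (U_(p.1) + m)%MM.
Proof. by move=> mg pm; apply: submK; apply: mbra_le. Qed.

(** The polarized quotient is exact by [bpol_mbra_le], so the additive map [mnm_depol] passes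
    through the subtraction. *)
Lemma depol_coef m p : mingen I m -> node m p ->
  mnm_depol (U_(enum_rank p) + bpol d m - bpol d (mbra I m p.1))%MM = mquot m p.
Proof.
move=> mg pm; apply/eqP; rewrite -(eqm_add2r (mbra I m p.1)) mquotK //.
have [ig _ _] := mbraP borelI mg (andP pm).2.
rewrite -[X in (_ + X)%MM](mnm_depol_bpol (degI ig)) -mnm_depolD submK
  ?bpol_mbra_le //.
by rewrite mnm_depolD mnm_depolU mnm_depol_bpol ?degI.
Qed.

(** The second sum may run over all of F, since [depolPe] vanishes on pairs that are not
    admissible. *)
Definition depolPdiff q F m : free_mod {mpoly k[n]} (Pbasis d I q.+1) :=
  \sum_(p in F) (((-1) ^+ pos F p * 'X_p.1) *: depolPe q (F :\ p) m
    - ((-1) ^+ pos F p * 'X_[mquot m p]) *: depolPe q (F :\ p) (mbra I m p.1)).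

Lemma dbasisE q (x : Pbasis d I q.+2) :
  dbasis (f := depolP) x = depolPdiff q (val x).1 (val x).2.
Proof.
apply: etrans (map_free_comb depol _ _ _ _ _ _) _.
rewrite [X in _ - X]big_mkcondr -sumrB.
have /andP[/admissibleP[mg hF] _] := valP x.
apply: eq_bigr => p pF; have pm := hF p pF.
have e1 : depol ((-1) ^+ pos (val x).1 p * xvar p.1 p.2 : {mpoly k[nvar n d]})
    = (-1) ^+ pos (val x).1 p * 'X_p.1.
  by rewrite rmorphM rmorph_sign /= depol_xvar.
have e2 : depol ((-1) ^+ pos (val x).1 p * 'X_[U_(enum_rank p)
      + bpol d (val x).2 - bpol d (mbra I (val x).2 p.1)] : {mpoly k[nvar n d]})
    = (-1) ^+ pos (val x).1 p * 'X_[mquot (val x).2 p].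
  by rewrite rmorphM rmorph_sign /= depolX depol_coef.
rewrite /= e1 e2 2!map_free_Pe.
by case: ifP => [_|/negbT/(depolPe_eq0 q) ->] //; rewrite scaler0.
Qed.

Lemma depolPe_delta q (x : Pbasis d I q.+1) F m :
  (val x).1 = F -> (val x).2 = m :> 'X_{1..n} -> depolPe q F m = delta x.
Proof.
move=> <- <-; apply/ffunP=> y; rewrite depolPeE ffunE.
rewrite -[y == x]val_eqE; case: (val y) (val x) => [a b] [a' b'] /=.
by rewrite xpair_eqE bmeqP.
Qed.

Lemma Pbasis_of q F m : admissible I F m -> #|F| = q ->
  exists x : Pbasis d I q.+1, (val x).1 = F /\ (val x).2 = m :> 'X_{1..n}.
Proof.
move=> a cF; have mb : (mdeg m < d.+1)%N by rewrite ltnS;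
  case/admissibleP: a => /degI.
pose x0 : {set 'I_n * 'I_d} * 'X_{1..n < d.+1} := (F, BMultinom mb).
have xP : admissible I x0.1 x0.2 && (#|x0.1| == q) by rewrite /= a cF eqxx.
by exists (Sub x0 xP); rewrite SubK.
Qed.

Lemma diffE q F m : admissible I F m -> #|F| = q.+1 ->
  diff depolP q.+1 (depolPe q.+1 F m) = depolPdiff q F m.
Proof.
move=> a cF; have [x [xF xm]] := Pbasis_of a cF.
by rewrite (depolPe_delta xF xm) diff_delta dbasisE xF xm.
Qed.

Lemma dbasis0E (x : Pbasis d I 1) :
  dbasis (f := depolP) x = [ffun => 'X_[(val x).2]].
Proof.
apply/ffunP=> t; rewrite !ffunE /= depolX mnm_depol_bpol //.
by rewrite -ltnS bmdeg.
Qed.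
Lemma diff0E F m : admissible I F m -> #|F| = 0%N ->
  diff depolP 0 (depolPe 0 F m) = [ffun => 'X_[m]].
Proof.
move=> a cF; have [x [xF xm]] := Pbasis_of a cF.
by rewrite (depolPe_delta xF xm) diff_delta dbasis0E xm.
Qed.

(** Removing p lowers the position of the later p' by one, while removing p' leaves that of p: the
    usual sign of d o d. *)
Lemma pos_exchange F p p' : p \in F -> p' \in F -> (p.1 < p'.1)%N ->
  (pos F p + pos (F :\ p) p').+1 = (pos F p' + pos (F :\ p') p)%N.
Proof.
move=> pF p'F lt.
have -> : pos (F :\ p') p = pos F p.
  apply: eq_card => x; rewrite !inE; case: eqP => //= ->.
  by rewrite leqNgt lt andbF.
rewrite addnC -addSn; congr addn.
rewrite /pos [in RHS](cardsD1 p) !inE pF ltnW //= add1n; congr _.+1.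
by apply: eq_card => x; rewrite !inE andbA.
Qed.

Lemma sum_antisym (T : finType) (V : zmodType) (A : {set T}) (key : T -> nat)
    (f : T -> T -> V) :
  {in A &, injective key} ->
  {in A &, forall x y, (key x < key y)%N -> f y x = - f x y} ->
  \sum_(x in A) \sum_(y in A :\ x) f x y = 0.
Proof.
move=> kinj fanti.
transitivity (\sum_(x in A) \sum_(y in A | (key x < key y)%N) f x y
            + \sum_(y in A) \sum_(x in A | (key x < key y)%N) f y x).
  rewrite -big_split; apply: eq_bigr => x xA /=.
  rewrite (bigID (fun y => key x < key y)%N) /=; congr (_ + _);
    apply: eq_bigl => y.
    rewrite !inE; case: eqP => //= ->.
    by rewrite ltnn andbF.
  rewrite !inE -leqNgt ltn_neqAle; have [yA|] := boolP (y \in A);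
    rewrite ?andbF //=.
  by rewrite andbT (inj_in_eq kinj).
rewrite [X in _ + X](exchange_big_dep (mem A)) /=; last by move=> ? ? ? /andP[].
rewrite -big_split big1 // => x xA /=.
rewrite [X in _ + X](eq_bigl (fun y => (y \in A) && (key x < key y)%N));
  last first.
  by move=> y; rewrite xA.
by rewrite -big_split big1 // => y /andP[yA lt] /=;
  rewrite (fanti x y) // addrN.
Qed.

Lemma node_key_inj F m : admissible I F m ->
  {in F &, injective (fun p : 'I_n * 'I_d => p.1 : nat)}.
Proof.
case/admissibleP=> _ hF p p' pF p'F /val_inj;
  exact: node_inj (hF p pF) (hF p' p'F).
Qed.

(** The cancellation without monomials: [z0], [zi], [zj] are the terms at m, m_<p>, m_<p'>, [zij]
    and [zji] those of the two double moves, and [ai], [aj] say whether the pairs after the single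
    moves are admissible. The hypotheses are the alternatives of [mbra_exchange], with inadmissible
    terms set to zero. *)
Lemma double_cancel (V : zmodType) (z0 zi zj zij zji : V) (ai aj : bool) :
  (~~ aj -> zj = 0) ->
  [/\ ~~ ai, zji = zi & ~~ aj -> zi = 0]
  \/ [/\ zij = zji, ~~ ai || ~~ aj -> zji = 0 & ~~ ai -> zi = 0] ->
  z0 - zj - (if ai then zi - zij else 0) = z0 - zi - (if aj then zj - zji else
    0).
Proof.
case: ai aj => [] [] /= Hj [[// _ e Hi]|[<- Hw Hi]];
  rewrite ?(Hj isT) ?(Hw isT) ?(Hi isT) ?e ?subr0 ?opprB ?addr0 //.
- by rewrite addrACA [RHS]addrACA [- zj - _]addrC.
- by rewrite addrA subrK.
Qed.

Lemma scale_comb (R : comNzRingType) (V : lmodType R) (s s' a b a' b' c' : R)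
    (e0 ei ej eij : V) :
  (s * a) *: ((s' * a') *: e0 - (s' * b') *: ej)
  - (s * b) *: ((s' * a') *: ei - (s' * c') *: eij)
  = (s * s') *: ((a * a') *: e0 - (a * b') *: ej
                 - ((b * a') *: ei - (b * c') *: eij)).
Proof. by rewrite !scalerBr !scalerA ![s * s' * _]mulrACA. Qed.

Lemma scale_comb0 (R : comNzRingType) (V : lmodType R) (s s' a a' b' : R)
    (e0 ej : V) :
  (s * a) *: ((s' * a') *: e0 - (s' * b') *: ej)
  = (s * s') *: ((a * a') *: e0 - (a * b') *: ej).
Proof. by rewrite !scalerBr !scalerA ![s * s' * _]mulrACA. Qed.

Section DoubleDiff.
Variables (q : nat) (F : {set 'I_n * 'I_d}) (m : 'X_{1..n}).
Hypothesis admF : admissible I F m.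
Hypothesis cF : #|F| = q.+2.

Let Z p p' u : free_mod {mpoly k[n]} (Pbasis d I q.+1) :=
  'X_[U_(p.1) + U_(p'.1) + m - u] *: depolPe q (F :\ p :\ p') u.

(** What removing p and then p' contributes, up to sign. The conditional matters: if the pair at
    m_<p> is not admissible, its basis vector is zero and has no boundary, although the pair left
    after removing p' as well may be admissible. *)
Let G p p' : free_mod {mpoly k[n]} (Pbasis d I q.+1) := Z p p' m - Z p p' (mbra
  I m p'.1) -
  (if admissible I (F :\ p) (mbra I m p.1)
   then Z p p' (mbra I m p.1) - Z p p' (mbra I (mbra I m p.1) p'.1) else 0).

Let ZC p p' : Z p p' =1 Z p' p.
Proof.
have eF : F :\ p :\ p' = F :\ p' :\ p by apply/setP=> x; rewrite !inE andbCA.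
by move=> u; rewrite /Z [(U_(p.1) + _)%MM]addmC eF.
Qed.

Let Z_eq0 p p' u : ~~ admissible I (F :\ p :\ p') u -> Z p p' u = 0.
Proof. by move=> h; rewrite /Z depolPe_eq0 ?scaler0. Qed.

Let G_sym p p' : p \in F -> p' \in F -> (p.1 < p'.1)%N -> G p p' = G p' p.
Proof.
move=> pF p'F lt; rewrite /G !(ZC p' p).
have [h0 h] := mbra_exchange borelI admF pF p'F lt.
apply: double_cancel; first by move/(contra h0); apply: Z_eq0.
case: h => [[h1 e h2]|[e h1 h2]]; [left|right]; split.
- exact: h1.
- by rewrite e.
- by move/(contra h2); apply: Z_eq0.
- by rewrite e.
- by rewrite -negb_and => h; apply: Z_eq0; apply: contra h => /h1 [-> ->].
- by move/(contra h2); apply: Z_eq0.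
Qed.

Let mono_eq p p' u a b :
  (a + b + u)%MM = (U_(p.1) + U_(p'.1) + m)%MM ->
  'X_[a] * 'X_[b] = 'X_[U_(p.1) + U_(p'.1) + m - u] :> {mpoly k[n]}.
Proof. by move=> <-; rewrite addmK mpolyXD. Qed.

Lemma diff_depolPdiff : diff depolP q.+1 (depolPdiff q.+1 F m) = 0.
Proof.
have /admissibleP[mg hF] := admF.
transitivity (\sum_(p in F) \sum_(p' in F :\ p)
  ((-1) ^+ pos F p * (-1) ^+ pos (F :\ p) p') *: G p p'); last first.
  apply: sum_antisym (node_key_inj admF) _ => p p' pF p'F lt.
  rewrite -(G_sym pF p'F lt) -scaleNr; congr (_ *: _).
  by rewrite -!exprD -(pos_exchange pF p'F lt) exprS mulN1r.
rewrite diff_sum; apply: eq_bigr => p pF; have pm := hF p pF.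
have [ig _ _] := mbraP borelI mg (andP pm).2.
have cFp : #|F :\ p| = q.+1 by have := cardsD1 p F; rewrite pF cF => -[].
have aFp : admissible I (F :\ p) m.
  by apply/admissibleP; split=> // x; rewrite !inE => /andP[_ /hF].
rewrite diff_comb.
rewrite (diffE aFp cFp).
have -> : diff depolP q.+1 (depolPe q.+1 (F :\ p) (mbra I m p.1)) =
    \sum_(p' in F :\ p) if admissible I (F :\ p) (mbra I m p.1) then
      ((-1) ^+ pos (F :\ p) p' * 'X_p'.1) *: depolPe q (F :\ p :\ p') (mbra I m
        p.1)
      - ((-1) ^+ pos (F :\ p) p' * 'X_[mquot (mbra I m p.1) p'])
        *: depolPe q (F :\ p :\ p') (mbra I (mbra I m p.1) p'.1) else 0.
  case: (boolP (admissible _ _ _)) => [a|/(depolPe_eq0 q.+1) ->].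
    by rewrite (diffE a cFp).
  by rewrite diff0 big1.
rewrite /depolPdiff !scaler_sumr -sumrB; apply: eq_bigr => p' p'Fp.
have p'F : p' \in F by move: p'Fp; rewrite inE => /andP[].
have p'm := hF p' p'F.
have e1 : 'X_p.1 * 'X_p'.1 = 'X_[U_(p.1) + U_(p'.1) + m - m] :> {mpoly k[n]}.
  exact: mono_eq.
have e2 : 'X_p.1 * 'X_[mquot m p'] =
   'X_[U_(p.1) + U_(p'.1) + m - mbra I m p'.1] :> {mpoly k[n]}.
  by apply: mono_eq; rewrite -addmA mquotK // addmA.
have e3 : 'X_[mquot m p] * 'X_p'.1 =
   'X_[U_(p.1) + U_(p'.1) + m - mbra I m p.1] :> {mpoly k[n]}.
  by apply: mono_eq; rewrite addmC addmA [(mbra _ _ _ + _)%MM]addmC mquotK //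
    -addmA [(m + _)%MM]addmC addmA.
rewrite /G /Z.
case: (boolP (admissible I (F :\ p) (mbra I m p.1))) => a.
  have p'ig : node (mbra I m p.1) p' by case/admissibleP: a => _; apply.
  have e4 : 'X_[mquot m p] * 'X_[mquot (mbra I m p.1) p'] =
   'X_[U_(p.1) + U_(p'.1) + m - mbra I (mbra I m p.1) p'.1] :> {mpoly k[n]}.
    apply: mono_eq; rewrite -addmA mquotK // [(U_(p'.1) + _)%MM]addmC addmA.
    by rewrite mquotK // -addmA [(m + _)%MM]addmC addmA.
  rewrite -e1 -e2 -e3 -e4.
  apply: scale_comb.
rewrite scaler0 2!subr0 -e1 -e2.
apply: scale_comb0.
Qed.

End DoubleDiff.

End Depolarized.

(** * Division of a polynomial by the smallest variable of each monomial *)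

Section Filt.
Variables (R : comNzRingType) (n : nat).
Implicit Types (f g : {mpoly R[n]}) (e u : 'X_{1..n}) (j l : 'I_n) (c : nat).

Definition low0 c u : bool := [forall l : 'I_n, (l < c)%N ==> (u l == 0%N)].

Lemma low0P c u : reflect (forall l : 'I_n, (l < c)%N -> u l = 0%N) (low0 c u).
Proof.
by apply: (iffP forallP) => h l; have := h l;
  [move/implyP=> h' /h' /eqP|move=> h'; apply/implyP=> /h' /eqP].
Qed.

(** One operator for two uses: with e = U_(c) it selects the monomials whose smallest variable is
    x_c and divides them by it; with e = 0 it sets the variables of index below c to zero. *)
Definition low_shift c e f : {mpoly R[n]} :=
  \sum_(u : 'X_{1..n < msize f})
    (if low0 c u then f@_(u + e) else 0) *: 'X_[u].

Lemma mcoeff_low_shift c e f u :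
  (low_shift c e f)@_u = if low0 c u then f@_(u + e) else 0.
Proof.
have [uf|uf] := ltnP (mdeg u) (msize f).
  exact: (mcoeff_mpoly (fun u => if low0 c u then f@_(u + e) else 0)).
rewrite (memN_msupp_eq0 (p := f)) ?if_same; last first.
  by apply: msize_mdeg_ge; rewrite mdegD (leq_trans uf) ?leq_addr.
rewrite /low_shift raddf_sum big1 // => v _ /=; rewrite mcoeffZ mcoeffX.
case: eqP => [vu|_]; last by rewrite mulr0.
by move: uf; rewrite -vu leqNgt bmdeg.
Qed.

Lemma low_shift0 c e : low_shift c e 0 = 0.
Proof. by apply/mpolyP=> u; rewrite mcoeff_low_shift !mcoeff0 if_same. Qed.

Lemma low_shiftD c e f g : low_shift c e (f + g) = low_shift c e f + low_shift
  c e g.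
Proof.
apply/mpolyP=> u; rewrite mcoeffD !mcoeff_low_shift mcoeffD.
by case: ifP; rewrite ?addr0.
Qed.

Lemma low_shiftN c e f : low_shift c e (- f) = - low_shift c e f.
Proof. by apply/eqP; rewrite -addr_eq0 -low_shiftD addNr low_shift0. Qed.

Lemma low_shift_sign c e (i : nat) f : low_shift c e ((-1) ^+ i * f) = (-1) ^+
  i * low_shift c e f.
Proof. by rewrite -signr_odd !mulr_sign; case: odd; rewrite ?low_shiftN. Qed.

Lemma low_shift_sum c e (J : Type) (r : seq J) (P : pred J) F :
  low_shift c e (\sum_(j <- r | P j) F j) = \sum_(j <- r | P j) low_shift c e
    (F j).
Proof. by apply: big_morph; [apply: low_shiftD|apply: low_shift0]. Qed.

Lemma mcoeff_mulX j f u :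
  ('X_j * f)@_u = if (0 < u j)%N then f@_(u - U_(j)) else 0.
Proof.
rewrite mulrC; case: ifP => uj.
  have ju : (U_(j) <= u)%MM by rewrite lep1mP -lt0n.
  by rewrite -{1}(submK ju) addmC mcoeffMX.
apply: memN_msupp_eq0; rewrite (perm_mem (msuppMX _ _)).
by apply/mapP=> -[v _ e]; move: uj; rewrite e mnmDE mnm1E eqxx.
Qed.

Definition div_var j f := low_shift j U_(j) f.
Definition kill_low c f := low_shift c 0 f.

Lemma div_var_mulX j f : div_var j ('X_j * f) = kill_low j f.
Proof.
apply/mpolyP=> u; rewrite !mcoeff_low_shift mcoeff_mulX mnmDE mnm1E eqxx addn1
  /=.
by rewrite addmK addm0.
Qed.

Lemma div_var_mulX_gt j l f : (j < l)%N -> div_var j ('X_l * f) = 'X_l *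
  div_var j f.
Proof.
move=> jl; apply/mpolyP=> u; rewrite mcoeff_mulX !mcoeff_low_shift mcoeff_mulX.
rewrite mnmDE mnm1E -val_eqE (ltn_eqF jl) addn0.
case ul: (0 < u l)%N; last by rewrite if_same.
have lu : (U_(l) <= u)%MM by rewrite lep1mP -lt0n.
have -> : low0 j (u - U_(l)) = low0 j u.
  apply: eq_forallb => x; case: ltnP => //= xj; rewrite mnmBE mnm1E -val_eqE.
  by rewrite (gtn_eqF (ltn_trans xj jl)) subn0.
by rewrite [(u - _ + _)%MM]addmC (addmBA _ lu) [(U_(j) + u)%MM]addmC.
Qed.

Lemma div_var_mulX_lt j l f : (l < j)%N -> div_var j ('X_l * f) = 0.
Proof.
move=> lj; apply/mpolyP=> u; rewrite mcoeff_low_shift mcoeff_mulX mcoeff0.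
case: ifP => // /low0P /(_ l lj) ul; rewrite mnmDE ul mnm1E -val_eqE.
by rewrite (gtn_eqF lj).
Qed.

(** A monomial with a variable of index below c is recovered from exactly one j, its smallest
    variable. *)
Lemma sum_mulX_div_var c f : \sum_(j < n | (j < c)%N) 'X_j * div_var j f = f -
  kill_low c f.
Proof.
apply/mpolyP=> u; rewrite raddf_sum mcoeffB mcoeff_low_shift addm0 /=.
have cE (j : 'I_n) : ('X_j * div_var j f)@_u = if (0 < u j)%N && low0 j u then
  f@_u else 0.
  rewrite mcoeff_mulX mcoeff_low_shift; case: ifP => //= uj.
  have ju : (U_(j) <= u)%MM by rewrite lep1mP -lt0n.
  rewrite submK //; congr (if _ then _ else _).
  apply: eq_forallb => x; case: ltnP => //= xj; rewrite mnmBE mnm1E -val_eqE.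
  by rewrite (gtn_eqF xj) subn0.
under eq_bigr do rewrite cE.
case: (boolP (low0 c u)) => [/low0P h|].
  by rewrite subrr big1 // => j jc; rewrite h.
rewrite negb_forall subr0 => /existsP[j0]; rewrite negb_imply => j0P.
case: (@arg_minnP _ j0 (fun l => (l < c) && (u l != 0))%N (fun l : 'I_n => l :
  nat) j0P).
move=> j /andP[jc uj] jmin; rewrite (bigD1 j) //= lt0n uj /=.
have -> : low0 j u.
  apply/low0P=> l lj; apply/eqP; apply: contraTT lj => ul; rewrite -leqNgt.
  by case: (ltnP l c) => lc; [apply: jmin; rewrite lc|apply: ltnW;
    apply: leq_trans lc].
rewrite big1 ?addr0 // => l /andP[lc lj]; case: ifP => // /andP[ul /low0P hl].
have /(_ _) := jmin l; rewrite lc -lt0n ul => /(_ isT).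
rewrite leq_eqVlt => /predU1P[/val_inj e|/hl]; last by move/eqP;
  rewrite (negPf uj).
by move: lj; rewrite e eqxx.
Qed.

End Filt.

(** * The contracting homotopy of the Koszul complex *)

Section Koszul.
Variables (k : fieldType) (n d : nat) (m : 'X_{1..n}).
Hypothesis md : (mdeg m <= d)%N.
Implicit Types (F : {set 'I_n * 'I_d}) (V : {set 'I_n * 'I_d} -> {mpoly k[n]}).
Implicit Types (p : 'I_n * 'I_d).

(** The Koszul differential read at the target: V lists the coefficients of a chain, and the sum
    collects what the sets with one more element send to F. *)
Definition koszul_diff V F : {mpoly k[n]} :=
  \sum_(p | node m p && (p \notin F))
     (-1) ^+ pos (p |: F) p * ('X_p.1 * V (p |: F)).

(** Also read at the target. For a set of nodes the sum has at most one term, at the first element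
    of F: the homotopy takes out the smallest variable of a monomial and adds it in front of the
    set. *)
Definition koszul_homotopy V F : {mpoly k[n]} :=
  \sum_(p in F | [forall p' in F, (p.1 <= p'.1)%N]) div_var p.1 (V (F :\ p)).

Lemma koszul_homotopyE V F p : (forall p', p' \in F -> node m p') -> p \in F ->
  (forall p', p' \in F -> (p.1 <= p'.1)%N) -> koszul_homotopy V F = div_var p.1
    (V (F :\ p)).
Proof.
move=> Fn pF pmin; rewrite /koszul_homotopy (bigD1 p) /=; last first.
  by rewrite pF; apply/forall_inP.
rewrite big1 ?addr0 // => p' /andP[/andP[p'F /forall_inP p'min] ne].
case/eqP: ne; apply: node_inj (Fn _ p'F) (Fn _ pF) _; apply: val_inj.
by apply/eqP; rewrite eqn_leq pmin // p'min.
Qed.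

Lemma sum_node (V : zmodType) c (f : 'I_n -> V) : (c <= (nu m).-1)%N ->
  \sum_(p : 'I_n * 'I_d | node m p && (p.1 < c)%N) f p.1
  = \sum_(j < n | (j < c)%N) f j.
Proof.
move=> cm.
transitivity (\sum_(j < n | (j < c)%N)
    \sum_(b < d | b == cumul m j :> nat) f j); last first.
  apply: eq_bigr => j jc.
  have jlt : (cumul m j < mdeg m)%N by rewrite -nu_cs; lia.
  by rewrite (big_pred1 (Ordinal (leq_trans jlt md))).
rewrite pair_big_dep /=; apply: eq_bigl => -[j b] /=; rewrite /node /= andbC.
case: ltnP => //= jc; have -> : (cumul m j < mdeg m)%N by rewrite -nu_cs; lia.
by rewrite andbT.
Qed.

(** The homotopy identity on a cycle; the minus sign comes from positions starting at 1. At the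
    empty set the variable-free part of V must be excluded, since the homotopy does not reach it. *)
Lemma koszul_htpy V F : (forall p, p \in F -> node m p) ->
  (F = set0 -> kill_low (nu m).-1 (V F) = 0) ->
  (forall p, p \in F -> koszul_diff V (F :\ p) = 0) ->
  koszul_diff (koszul_homotopy V) F = - V F.
Proof.
move=> Fn F0 Fd; have [e|/set0Pn[q0 q0F]] := eqVneq F set0.
  rewrite -[in RHS](subr0 (V F)) -(F0 e) -sum_mulX_div_var -(sum_node (fun j =>
    'X_j * div_var j (V F))) //.
  rewrite -sumrN; apply: eq_big => [p|p /andP[pn pF]].
    rewrite e inE; case: (boolP (node m p)) => //= /andP[_]; rewrite -nu_cs;
      lia.
  have p1 : p |: F = [set p] by rewrite e setU0.
  rewrite (@koszul_homotopyE _ _ p); last first.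
  - by move=> p'; rewrite p1 inE => /eqP ->.
  - by rewrite setU11.
  - by move=> p'; rewrite p1 inE => /eqP ->.
  have -> : (p |: F) :\ p = F by rewrite setU1K.
  have -> : pos (p |: F) p = 1%N.
    rewrite /pos p1 -(cards1 p); apply: eq_card => x; rewrite !inE.
    by case: eqP => // ->; rewrite leqnn.
  by rewrite expr1 mulN1r.
case: (@arg_minnP _ q0 (fun p => p \in F) (fun p => p.1 : nat) q0F) => p0 p0F
  p0min.
have p0n := Fn _ p0F; have /andP[_ p0lt] := p0n.
pose F' := F :\ p0; have FF' : F = p0 |: F' by rewrite setD1K.
have key p : node m p -> p != p0 -> (p.1 != p0.1 :> nat).
  by move=> pn; apply: contra => /eqP e; apply/eqP/(node_inj pn p0n)/val_inj.
have Un p : node m p -> forall p', p' \in p |: F -> node m p'.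
  by move=> pn p'; rewrite !inE => /predU1P[->|/Fn].
have low p : (p.1 < p0.1)%N -> p \notin F.
  by move=> lt; apply/negP => /p0min; rewrite leqNgt lt.
have low' p : (p.1 < p0.1)%N -> p \notin F'.
  by move=> lt; rewrite !inE negb_and low ?orbT.
have hi p : (p0.1 < p.1)%N -> (p \notin F) = (p \notin F').
  by move=> lt; rewrite !inE; case: eqP lt => // ->; rewrite ltnn.
pose S := \sum_(p | [&& node m p, p \notin F' & (p0.1 < p.1)%N])
   (-1) ^+ pos (p |: F') p * ('X_p.1 * V (p |: F')).
(* The cycle condition at F without its first element p0, divided by x_p0: the terms of smaller
   index vanish under this division. *)
have DS : div_var p0.1 S = kill_low p0.1 (V F).
  have := Fd _ p0F; rewrite -/F' /koszul_diff (bigD1 p0) /=;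
    last by rewrite p0n !inE eqxx.
  rewrite (bigID (fun p : 'I_n * 'I_d => (p0.1 < p.1)%N)) /=.
  move/(congr1 (div_var p0.1));
    rewrite /div_var low_shift0 !low_shiftD -!/(div_var _ _).
  rewrite -FF' (_ : pos F p0 = 1%N); last first.
    rewrite /pos -(cards1 p0); apply: eq_card => x; rewrite !inE.
    apply/andP/eqP => [[xF xp0]|->]; last by rewrite p0F.
    apply: (node_inj (Fn _ xF) p0n); apply: val_inj; apply/eqP.
    by rewrite eqn_leq xp0 p0min.
  rewrite /div_var low_shift_sign -/(div_var _ _) div_var_mulX expr1 mulN1r.
  set A := \sum_(i | _) _; set B := \sum_(i | _) _.
  have -> : A = S.
    apply: eq_bigl => p; rewrite -!andbA; congr (_ && (_ && _)).
    case: (ltnP p0.1 p.1) => lt; rewrite ?andbF // !andbT.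
    suff -> : p != p0 by rewrite andbT.
    by apply/eqP=> e; rewrite e ltnn in lt.
  have -> : low_shift p0.1 U_(p0.1) B = 0.
    rewrite low_shift_sum big1 // => p /andP[/andP[/andP[pn pF'] pp0]].
    rewrite -leqNgt leq_eqVlt (negPf (key p pn pp0)) /= => lt.
    by rewrite low_shift_sign -/(div_var _ _) div_var_mulX_lt // mulr0.
  by rewrite addr0 => /eqP; rewrite addrC subr_eq0 => /eqP.
(* An added p before p0 becomes the new first element and yields the telescoping sum of
   [sum_mulX_div_var]; a p after p0 leaves p0 first and yields S, which cancels the remainder by
   [DS]. *)
rewrite /koszul_diff (bigID (fun p : 'I_n * 'I_d => (p.1 < p0.1)%N)) /=.
rewrite [X in X + _](_ : _ = kill_low p0.1 (V F) - V F); last first.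
  rewrite -opprB -sum_mulX_div_var -(sum_node (fun j => 'X_j * div_var j (V
    F))); last first.
    by move: p0lt; rewrite -nu_cs; case: (nu m) => // x /ltnW.
  rewrite -sumrN; apply: eq_big => [p|p /andP[/andP[pn pF] lt]].
    by case: ltnP => lt; rewrite ?andbF // !andbT low ?andbT.
  have pmin p' : p' \in p |: F -> (p.1 <= p'.1)%N.
    by rewrite !inE => /predU1P[->//|/p0min]; apply/leq_trans/ltnW.
  rewrite (@koszul_homotopyE _ _ p (Un p pn)) ?setU11 // setU1K //.
  have -> : pos (p |: F) p = 1%N.
    rewrite /pos -(cards1 p); apply: eq_card => x; rewrite !inE.
    apply/andP/eqP => [[/predU1P[//|/p0min xF] xp]|->]; last by rewrite eqxx.
    by move: (leq_trans xF xp); rewrite leqNgt lt.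
  by rewrite expr1 mulN1r.
rewrite [X in _ + X](_ : _ = - div_var p0.1 S);
  first by rewrite DS addrC addrA addNr add0r.
rewrite /div_var low_shift_sum -sumrN;
  apply: eq_big => [p|p /andP[/andP[pn pF] lt]].
  have [lt|lt|e] := ltngtP p.1 p0.1; rewrite ?andbF ?andbT //.
  - by rewrite hi.
  - have [->|ne] := eqVneq p p0; first by rewrite p0F !andbF.
    by case: (boolP (node m p)) => // pn; have := key p pn ne; rewrite e eqxx.
have {}lt : (p0.1 < p.1)%N.
  rewrite ltnNge leq_eqVlt (negPf lt) orbF; apply: key => //.
  by apply: contraNneq pF => ->.
rewrite low_shift_sign -/(div_var _ _) div_var_mulX_gt // (@koszul_homotopyE _
  _ p0 (Un p pn)); first last.
- move=> p'; rewrite !inE => /predU1P[->|/p0min //]; exact: ltnW.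
- by rewrite !inE p0F orbT.
have p0p : (p0 == p) = false by apply/eqP=> e; rewrite e ltnn in lt.
have -> : (p |: F) :\ p0 = p |: F'.
  apply/setP=> x; rewrite !inE.
  by case: (x =P p0) => [->|_] /=; rewrite ?p0p ?orbF.
have -> : pos (p |: F) p = (pos (p |: F') p).+1.
  rewrite /pos (cardsD1 p0) !inE p0F orbT ltnW //= add1n; congr _.+1.
  apply: eq_card => x; rewrite !inE.
  by case: (x =P p0) => [->|_] /=; rewrite ?p0p ?orbF.
by rewrite exprS mulN1r mulNr.
Qed.

End Koszul.

(** * The lexicographic order as a number *)

Section LexRank.
Variables (n d : nat).
Implicit Types (m u : 'X_{1..n}) (i j l : 'I_n).

(* Represents the lexicographic order on monomials of degree at most d. *)
Definition lexrank m : nat := (\sum_(i < n) m i * d.+1 ^ (n - i))%N.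

(** The exponents are digits in base d + 1. Those of m after i sum to at most d, so together they
    weigh less than one unit of the digit at i. *)
Lemma lexrank_lt m u i : (mdeg m <= d)%N ->
  (forall l, (l < i)%N -> m l = u l) -> (m i < u i)%N ->
  (lexrank m < lexrank u)%N.
Proof.
move=> md eq_lt lt; rewrite /lexrank.
rewrite (bigID (fun l : 'I_n => (l < i)%N)) /=.
rewrite [X in (_ < X)%N](bigID (fun l : 'I_n => (l < i)%N)) /=.
rewrite [X in (X + _ < _)%N](eq_bigr (fun l : 'I_n => u l * d.+1 ^ (n - l)))%N;
  last first.
  by move=> l /eq_lt ->.
rewrite ltn_add2l (bigD1 i) ?ltnn //= [X in (_ < X)%N](bigD1 i) ?ltnn //=.
have lo : (\sum_(l < n | ~~ (l < i)%N && (l != i)) m l * d.+1 ^ (n - l)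
           <= d * d.+1 ^ (n - i.+1))%N.
  apply: (@leq_trans (\sum_(l < n) m l * d.+1 ^ (n - i.+1))%N).
    rewrite [X in (_ <= X)%N](bigID (fun l : 'I_n => ~~ (l < i)%N && (l != i)))
      /=.
    apply: leq_trans (leq_addr _ _); apply: leq_sum => l /andP[li ne].
    rewrite leq_mul2l leq_pexp2l ?orbT // leq_sub2l //.
    by rewrite ltn_neqAle eq_sym -val_eqE in ne *; rewrite ne leqNgt.
  by rewrite -big_distrl /= -mdegE leq_mul2r md orbT.
have hB : (d.+1 ^ (n - i) = d.+1 * d.+1 ^ (n - i.+1))%N.
  by rewrite -expnS; congr expn; have := ltn_ord i; lia.
have B0 : (0 < d.+1 ^ (n - i.+1))%N by rewrite expn_gt0.
apply: leq_trans (leq_addr _ _); rewrite hB.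
apply: (@leq_trans ((m i).+1 * (d.+1 * d.+1 ^ (n - i.+1)))%N);
  last by rewrite leq_mul2r lt orbT.
move: lo B0; move: (\sum_(_ < n | _) _)%N (d.+1 ^ _)%N (m i) => L B x.
by clear; nia.
Qed.

Lemma lexrank_diff m u : (mdeg u <= d)%N ->
  (lexrank m <= lexrank u)%N -> m != u ->
  exists i, (forall l, (l < i)%N -> m l = u l) /\ (m i < u i)%N.
Proof.
move=> ud le ne.
have [i0 i0P] : exists i, m i != u i.
  apply/existsP; apply: contra_neqT ne; rewrite negb_exists => /forallP h.
  by apply/mnmP=> i; apply/eqP; have := h i; rewrite negbK.
case: (@arg_minnP _ i0 (fun l => m l != u l) (fun l : 'I_n => l : nat) i0P) =>
  i iP imin.
have eqb l : (l < i)%N -> m l = u l.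
  by move=> li; apply/eqP; apply: contraTT li => /imin; rewrite -leqNgt.
exists i; split=> //; rewrite ltn_neqAle iP leqNgt; apply/negP=> lt.
have := @lexrank_lt u m i ud (fun l li => esym (eqb l li)) lt.
by rewrite ltnNge le.
Qed.

Lemma lexrank_cs m u i : (mdeg m <= d)%N ->
  (forall l, (l < i)%N -> cumul m l = cumul u l) -> (cumul m i < cumul u i)%N ->
  (lexrank m < lexrank u)%N.
Proof.
move=> md eqb lt; apply: (@lexrank_lt _ _ i) => // [l li|].
  by apply: cumul_inj_on => x xl; apply: eqb; apply: leq_ltn_trans li.
case i0: (i : nat) => [|i']; first by rewrite -!(cumul_first _ i0).
have i'n : (i' < n)%N by have := ltn_ord i; lia.
move: lt; rewrite (@cumulS _ m (Ordinal i'n) i) // (@cumulS _ u (Ordinal i'n)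
  i) //.
by rewrite (eqb (Ordinal i'n)) /= ?i0 ?ltn_add2l.
Qed.

End LexRank.

(** * Exactness by induction on the lexicographic rank *)

Section Exactness.
Variables (k : fieldType) (n d : nat) (I : idealr {mpoly k[n]}).
Hypothesis borelI : borel_fixed I.
Hypothesis degI : forall m : 'X_{1..n}, mingen I m -> (mdeg m <= d)%N.
Implicit Types (m u : 'X_{1..n}) (F : {set 'I_n * 'I_d}) (p : 'I_n * 'I_d).

Local Notation P := (depolP d I).
Local Notation rk := (lexrank d).
Local Notation Pbas := (Pbasis d I).

(** The move increases the cumulative degree first at i, and the lower degree bound of [mbraP] keeps
    the truncation from undoing this. *)
Lemma lexrank_mbra m i : mingen I m -> (cumul m i < mdeg m)%N ->
  (rk m < rk (mbra I m i))%N.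
Proof.
move=> mg im; have [ig /andP[iL _] ip] := mbraP borelI mg im.
apply: (@lexrank_cs _ _ _ _ i) => [|l li|]; first exact: degI.
  rewrite ip leqNgt li /=; have := cumul_mono m (ltnW li); lia.
by rewrite ip leqnn eqxx; lia.
Qed.

(** At the first index where m' and m differ, m' is larger, so u contains that variable, and the
    assumption on u leaves m no letter beyond it. Hence m divides m', and minimality gives
    equality. *)
Lemma colon_lex m m' u : mingen I m -> mingen I m' -> (rk m <= rk m')%N ->
  low0 (nu m).-1 u -> (m' <= u + m)%MM -> m' = m.
Proof.
move=> mg m'g le /low0P ulow /mnm_lepP m'le.
have [->//|ne] := eqVneq m m'.
have [i [eqb lt]] := lexrank_diff (degI m'g) le ne.
have := m'le i; rewrite mnmDE => ui.
have iN : ~~ (i.+1 < nu m)%N.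
  apply/negP=> inu; have := ulow i; case: (nu m) inu => // x xi /(_ xi) u0.
  by move: ui; rewrite u0 leqNgt lt.
move: iN; rewrite nu_ltE negb_exists => /forallP h.
symmetry; apply: (mingen_min m'g _ (mingen_ideal mg)); apply/mnm_lepP=> l.
case: (ltngtP l i) => li; first by rewrite eqb.
  by have := h l; rewrite li /= -leqNgt leqn0 => /eqP ->.
by rewrite (val_inj li) ltnW.
Qed.

Definition component q (v : free_mod {mpoly k[n]} (Pbas q.+1)) m F : {mpoly
  k[n]} :=
  \sum_(x : Pbas q.+1 | ((val x).1 == F) && ((val x).2 == m :> 'X_{1..n})) v x.

Lemma Pbasis_inj q (x y : Pbas q.+1) :
  (val x).1 = (val y).1 -> (val x).2 = (val y).2 :> 'X_{1..n} -> x = y.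
Proof.
move=> e1 e2; apply: val_inj; case: (val x) (val y) e1 e2 => a b [a' b'] /= ->.
by move/val_inj ->.
Qed.

Lemma componentE q (v : free_mod {mpoly k[n]} (Pbas q.+1)) (x : Pbas q.+1) m F :
  (val x).1 = F -> (val x).2 = m :> 'X_{1..n} -> component v m F = v x.
Proof.
move=> <- <-; apply: big_pred1 => y.
apply/andP/eqP => [[/eqP e1 /eqP e2]|->]; last by rewrite !eqxx.
exact: Pbasis_inj e1 e2.
Qed.

Lemma diff_app q (v : free_mod {mpoly k[n]} (Pbas q.+2)) (c : Pbas q.+1) :
  (forall x : Pbas q.+2, v x != 0 -> (rk (val c).2 <= rk (val x).2)%N) ->
  diff P q.+1 v c = koszul_diff (val c).2 (component v (val c).2) (val c).1.
Proof.
move=> vK; pose F := (val c).1; pose m : 'X_{1..n} := (val c).2.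
transitivity (\sum_(x : Pbas q.+2) \sum_(p in (val x).1)
   if (F == (val x).1 :\ p) && (m == (val x).2 :> 'X_{1..n})
   then (-1) ^+ pos (val x).1 p * ('X_p.1 * v x) else 0).
  rewrite /diff sum_ffunE; apply: eq_bigr => x _.
  rewrite ffunE dbasisE //.
  have [v0|v0] := eqVneq (v x) 0.
    rewrite v0 scale0r big1 // => p _.
    by rewrite !mulr0 if_same.
  rewrite sum_ffunE scaler_sumr; apply: eq_bigr => p pF.
  have /andP[/admissibleP[mg hF] _] := valP x.
  have pm := hF p pF.
  rewrite !ffunE !depolPeE -/F -/m.
  (* Reaching [m] by a move would give it larger rank than a generator in the support of [v]. *)
  have -> : (m == mbra I (val x).2 p.1) = false.
    apply/eqP => e; have := vK x v0; rewrite -/m e leqNgt.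
    by rewrite lexrank_mbra //; case/andP: pm.
  rewrite andbF /=.
  case: ifP => _.
    by rewrite scaler0 subr0 /GRing.scale /= mulr1 mulrC mulrA.
  by rewrite !scaler0 subr0 scaler0.
rewrite (exchange_big_dep xpredT) //= /koszul_diff [RHS]big_mkcond;
  apply: eq_bigr => p _.
case: ifP => [/andP[pm pF]|h]; last first.
  rewrite big1 // => x px; case: ifP => // /andP[/eqP eF /eqP em].
  move: h; rewrite -/F -/m em eF !inE eqxx andbT.
  by have /andP[/admissibleP[_ /(_ p px) ->]] := valP x.
rewrite /component !mulr_sumr -big_mkcondr /=; apply: eq_big => [x|x].
  apply/and3P/andP => [[px /eqP eF /eqP em]|[/eqP eF /eqP em]].
    by rewrite -/F eF -/m em setD1K // !eqxx.
  by rewrite eF em setU11 setU1K // !eqxx.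
by case/and3P=> px /eqP eF _; rewrite -/F eF setD1K.
Qed.

Lemma diff0_app (v : free_mod {mpoly k[n]} (Pbas 1)) t :
  diff P 0 v t = \sum_(x : Pbas 1) v x * 'X_[(val x).2].
Proof.
by rewrite /diff sum_ffunE; apply: eq_bigr => x _;
  rewrite ffunE dbasis0E // ffunE.
Qed.

(** Take the coefficient of u m in the relation dv = 0, with u free of low variables: by [colon_lex]
    no other generator in the support divides u m, so the coefficient of u in [v c] is zero. *)
Lemma cycle_low (v : free_mod {mpoly k[n]} (Pbas 1)) (c : Pbas 1) : diff P 0 v
  = 0 ->
  (forall x : Pbas 1, v x != 0 -> (rk (val c).2 <= rk (val x).2)%N) ->
  kill_low (nu (val c).2).-1 (v c) = 0.
Proof.
move=> dv vK; apply/mpolyP=> u; rewrite mcoeff0 mcoeff_low_shift addm0.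
case: ifP => // ulow; pose m : 'X_{1..n} := (val c).2.
have := congr1 (fun f : free_mod _ _ => (f tt)@_(m + u)) dv.
rewrite diff0_app ffunE mcoeff0 raddf_sum (bigD1 c) //= mcoeffMX big1 ?addr0 //.
move=> x xc; have [->|v0] := eqVneq (v x) 0; first by rewrite mul0r mcoeff0.
apply: memN_msupp_eq0; rewrite (perm_mem (msuppMX _ _)); apply/mapP=> -[w _ e].
case/eqP: xc.
have /andP[/admissibleP[cg _] /eqP/cards0_eq cF] := valP c.
have /andP[/admissibleP[xg _] /eqP/cards0_eq xF] := valP x.
apply: Pbasis_inj; first by rewrite cF xF.
apply: (colon_lex cg xg (vK x v0) ulow).
by rewrite addmC e lem_addr.
Qed.

Definition homotopy q (v : free_mod {mpoly k[n]} (Pbas q.+1)) :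
    free_mod {mpoly k[n]} (Pbas q.+2) :=
  [ffun x : Pbas q.+2 => koszul_homotopy (component v (val x).2) (val x).1].

Lemma diff_homotopy q (v : free_mod {mpoly k[n]} (Pbas q.+1)) (c : Pbas q.+1) :
  diff P q v = 0 ->
  (forall x : Pbas q.+1, v x != 0 -> (rk (val c).2 <= rk (val x).2)%N) ->
  diff P q.+1 (homotopy v) c = - v c.
Proof.
move=> dv vK; have /andP[/admissibleP[cg cn] /eqP cF] := valP c.
rewrite diff_app; last first.
  (* The homotopy preserves the generator, so [homotopy v] obeys the same rank bound as v. *)
  move=> x; apply: contraR => xc; rewrite ffunE /koszul_homotopy big1 // => p _.
  rewrite [component _ _ _]big1 ?/div_var ?low_shift0 // => y /andP[_ /eqP ey].
  by apply/eqP; apply: contraR xc => /vK; rewrite ey.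
rewrite -(componentE v (x := c) erefl erefl) -(@koszul_htpy _ _ d _ (degI cg))
  //.
- apply: eq_bigr => p /andP[pn pF]; congr (_ * (_ * _)).
  have a : admissible I (p |: (val c).1) (val c).2.
    by apply/admissibleP; split=> // p' /setU1P[->|/cn].
  have cU : #|p |: (val c).1| = q.+1 by rewrite cardsU1 pF cF.
  have [x [xF xm]] := Pbasis_of degI a cU.
  by rewrite (componentE _ xF xm) ffunE xF xm.
(* An empty set means q = 0, the case treated by [cycle_low]. *)
- move=> F0; rewrite (componentE v (x := c)) //; move: q v c dv vK cF F0 cg cn.
  case=> [|q] v c dv vK cF F0 cg cn; first exact: cycle_low.
  by move: cF; rewrite F0 cards0.
move=> p pF; move: q v c dv vK cF cg cn pF; case=> [|q] v c dv vK cF cg cn pF.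
  by move: pF; rewrite (cards0_eq cF) inE.
have a : admissible I ((val c).1 :\ p) (val c).2.
  by apply/admissibleP; split=> // p'; rewrite !inE => /andP[_ /cn].
have cD : #|(val c).1 :\ p| = q.
  by have := cardsD1 p (val c).1; rewrite pF cF => -[].
have [x [xF xm]] := Pbasis_of degI a cD.
have := diff_app (c := x) (v := v); rewrite xm xF => <- //.
by rewrite dv ffunE.
Qed.

Lemma diff_diff q (v : free_mod {mpoly k[n]} (Pbas q.+2)) :
  diff P q (diff P q.+1 v) = 0.
Proof.
rewrite {2}/diff diff_sum big1 // => x _; rewrite diffZ dbasisE //.
have /andP[a /eqP cF] := valP x.
suff -> : diff P q (depolPdiff I q (val x).1 (val x).2) = 0 by rewrite scaler0.
(* Into degree 0 the check is direct: the remaining set is empty, so both pairs are admissible, and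
   both terms give the monomial x_i m. *)
move: q x a cF {v}; case=> [|q] x a cF; last exact: diff_depolPdiff.
move: ((val x).1) ((val x).2 : 'X_{1..n}) a cF => F m a cF.
have /admissibleP[mg hF] := a; rewrite /depolPdiff diff_sum big1 // => p pF.
have c0 : #|F :\ p| = 0%N by have := cardsD1 p F; rewrite pF cF => -[].
have pm := hF p pF; have /andP[_ plt] := pm.
have F0 := cards0_eq c0.
have a1 : admissible I (F :\ p) m.
  by apply/admissibleP; split=> // p'; rewrite F0 inE.
have a2 : admissible I (F :\ p) (mbra I m p.1).
  apply/admissibleP; split; last by move=> p'; rewrite F0 inE.
  by have [] := mbraP borelI mg plt.
rewrite diff_comb (diff0E degI a1 c0) (diff0E degI a2 c0).
apply/ffunP=> t; rewrite !ffunE /GRing.scale /= -!mulrA -!mpolyXD.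
by rewrite (mquotK borelI degI mg pm) subrr.
Qed.

Lemma diff_exact q (v : free_mod {mpoly k[n]} (Pbas q.+1)) :
  diff P q v = 0 -> exists w, diff P q.+1 w = v.
Proof.
pose top := (\max_(x : Pbas q.+1) (rk (val x).2).+1)%N.
(* All ranks lie strictly below [top], so N = 0 forces v = 0; each correction by the homotopy lowers
   N by one. *)
suff: forall N (v : free_mod {mpoly k[n]} (Pbas q.+1)), diff P q v = 0 ->
    (forall x : Pbas q.+1, v x != 0 -> (top <= rk (val x).2 + N)%N) ->
    exists w, diff P q.+1 w = v.
  by move=> h dv; apply: (h top) dv _ => x _; apply: leq_addl.
elim=> [|N IH] {}v dv vK.
  exists 0; rewrite diff0; apply/ffunP=> x; rewrite ffunE; symmetry; apply/eqP.
  apply: contraT => /vK; rewrite addn0 leqNgt.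
  by rewrite (leq_bigmax (F := fun x : Pbas q.+1 => (rk (val x).2).+1)).
have [||w wE] := IH (v + diff P q.+1 (homotopy v)).
- by rewrite diffD dv diff_diff addr0.
- move=> x; rewrite ffunE; apply: contraR; rewrite -ltnNge => lt.
  rewrite diff_homotopy // ?addrN // => y /vK; rewrite addnS; lia.
exists (w - homotopy v); rewrite diffB wE addrK //.
Qed.

End Exactness.

(** * Minimality and the augmentation *)

Section Resolution.
Variables (k : fieldType) (n d : nat) (I : idealr {mpoly k[n]}).
Hypothesis borelI : borel_fixed I.
Hypothesis degI : forall m : 'X_{1..n}, mingen I m -> (mdeg m <= d)%N.

Local Notation P := (depolP d I).
Local Notation is_var := (fun f : {mpoly k[n]} => exists i : 'I_n, f = 'X_i).

Lemma ideal_mul_mono (M : lmodType {mpoly k[n]}) (c : {mpoly k[n]}) u (e : M) :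
  u != 0%MM -> ideal_mul is_var ((c * 'X_[u]) *: e).
Proof.
move=> /mnm_maxvar[i [ui _]]; have iu : (U_(i) <= u)%MM by rewrite lep1mP -lt0n.
rewrite -(submK iu) mpolyXD mulrA mulrC -scalerA.
by apply: ideal_mul_gen; exists i.
Qed.

Lemma depolP_minimal : minimal P.
Proof.
move=> q v; rewrite /diff; apply: ideal_mul_sum => b _; apply: ideal_mulZ.
move: q b {v}; case=> [|q] b.
  have mP : mingen I (val b).2 by have /andP[/admissibleP[]] := valP b.
  rewrite dbasis0E // (_ : [ffun => _] = (1 * 'X_[(val b).2]) *: delta tt).
    by apply: ideal_mul_mono; apply: mingen_neq0 mP.
  by apply/ffunP=> -[]; rewrite !ffunE mul1r eqxx /GRing.scale /= mulr1.
have /andP[/admissibleP[mg hF] _] := valP b.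
rewrite dbasisE // /depolPdiff; apply: ideal_mul_sum => p pF;
  have pm := hF p pF.
apply: ideal_mulD.
  by apply: ideal_mul_mono; rewrite mnm1_eq0.
rewrite -scaleN1r; apply: ideal_mulZ; apply: ideal_mul_mono.
(* The quotient x_i m / m_<i> is not 1, as the degree of m_<i> is at most that of m. *)
apply/eqP=> e; have := mquotK borelI degI mg pm; rewrite e add0m.
move/(congr1 (@mdeg n)); rewrite mdegD mdeg1.
have [_ /andP[_ le] _] := mbraP borelI mg (andP pm).2.
by move=> e'; rewrite e' ltnn in le.
Qed.

(** The ideal comes with some set M of monomial generators; each of them is a multiple of a minimal
    generator, hence in the image. *)
Lemma im_diff0 (v : free_mod {mpoly k[n]} (basis P 0)) :
  (exists w, diff P 0 w = v) <-> v tt \in I.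
Proof.
split=> [[w <-]|vI].
  rewrite diff0_app //; apply: rpred_sum => x _; apply: idealMr.
  by apply: mingen_ideal; have /andP[/admissibleP[]] := valP x.
have [M hM] := borelI.1; have [r [a [z [Ma vE]]]] := (hM _).1 vI.
have aP i : exists w, diff P 0 w = [ffun => a i].
  have [m Mm am] := Ma i.
  have mI : 'X_[m] \in I.
    apply/hM; rewrite -[X in gen_ideal _ X]mulr1; apply: gen_ideal_gen.
    by exists m.
  have [g [gg /prefix_lepm gm]] := mingen_prefix borelI mI.
  have a0 : admissible I (set0 : {set 'I_n * 'I_d}) g.
    by apply/admissibleP; split=> // p; rewrite inE.
  exists ('X_[m - g] *: (depolPe I 0 set0 g : free_mod _ (Pbasis d I 1))).
  rewrite diffZ diff0E ?cards0 //; apply/ffunP=> t.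
  by rewrite !ffunE /GRing.scale /= -mpolyXD submK // am.
have [w wE] := fin_all_exists aP.
exists (\sum_i (z i : {mpoly k[n]}) *: w i); rewrite diff_sum.
apply/ffunP=> -[]; rewrite sum_ffunE vE; apply: eq_bigr => i _.
by rewrite diffZ wE !ffunE /GRing.scale /= mulrC.
Qed.

Lemma depolP_resolves : resolves_quotient P I.
Proof.
split; last first.
  move=> q v; split=> [|[w <-]]; first exact: diff_exact.
  exact: diff_diff.
pose aug (v : term P 0) : {ideal_quot I} := \pi_({ideal_quot I})%qT (v tt).
have lin_aug : linear_for (\pi_({ideal_quot I})%qT \; *%R) aug.
  by move=> a u v; rewrite /aug !ffunE rmorphD rmorphM.
pose augL : {linear term P 0 -> {ideal_quot I} | \pi_({ideal_quot I})%qT \;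
  *%R} :=
  HB.pack aug (GRing.isLinear.Build _ _ _ _ aug lin_aug).
exists augL; split=> [y|v].
  by exists [ffun => repr y]; rewrite /= /aug ffunE reprK.
rewrite im_diff0 /= /aug -[v tt in X in _ <-> X]subr0 Quotient.idealrBE.
by rewrite raddf0; split=> [->|/eqP].
Qed.

End Resolution.

Theorem corollary4p2 (k : fieldType) (n d : nat) (I : idealr {mpoly k[n]})
    (d_gt0 : (0 < d)%N) (borelI : borel_fixed I)
    (degI : forall m : 'X_{1..n}, mingen I m -> (mdeg m <= d)%N) :
  [/\ quotient_map (@Theta k n d) depol,
      forall (i : 'I_n) (j : 'I_d), depol (@xvar k n d i j) = 'X_i,
      resolves_quotient (base_change depol (Pcomplex d I)) I &
      minimal (base_change depol (Pcomplex d I))].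
Proof.
split.
- exact: depol_quotient_map.
- exact: depol_xvar.
- exact: depolP_resolves.
exact: depolP_minimal.
Qed.
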